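(* Let $N\ge1$ be an integer. Fix initial data $\theta_1^0,\dots,\theta_N^0,\omega_1^0,\dots,\omega_N^0\in\mathbb{R}$, intrinsic velocities $\nu_1,\dots,\nu_N\in\mathbb{R}$, and a coupling strength $\kappa>0$. For each $m>0$ let $\theta_1(m,t),\dots,\theta_N(m,t)$, $t\ge0$, be the solution of the inertial Kuramoto Cauchy problem with inertia $m$, and let $\theta_1(0,t),\dots,\theta_N(0,t)$, $t\ge0$, be the solution of the first-order Kuramoto Cauchy problem (both given in the context). Then the following hold. (1) For each $i\in[N]$, $\theta_i(m,\cdot)\to\theta_i(0,\cdot)$ as $m\to0^+$ in the Fréchet topology of $C^0([0,\infty))$. Quantitatively, for all $m>0$, $$|\theta_i(m,t)-\theta_i(0,t)|\le m\left(2\max_{j\in[N]}|\omega_j^0-\nu_j|+\kappa\right)e^{2\kappa t},\qquad i\in[N],\ t\ge0.$$ (2) For each $i\in[N]$, $\theta_i(m,\cdot)\to\theta_i(0,\cdot)$ as $m\to0^+$ in the Fréchet topology of $C^\infty(0,\infty)$. Quantitatively, for all $m>0$, all integers $n\ge1$, all $i\in[N]$ and all $t\ge0$, $$|\theta_i^{(n)}(m,t)-\theta_i^{(n)}(0,t)|\le (n+1)!\,2^n\left(\kappa+\max_{j\in[N]}|\omega_j^0|+\max_{j\in[N]}|\nu_j|+\frac1m\right)^n\left(\left(1+\frac tm\right)^n e^{-t/m}\left(1+m\kappa e^{2\kappa t}\right)+m\kappa e^{2\kappa t}\right).$$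
   Context: $[N]=\{1,\dots,N\}$. The inertial Kuramoto Cauchy problem with inertia $m>0$ is $$m\ddot\theta_i+\dot\theta_i=\nu_i+\frac{\kappa}{N}\sum_{j=1}^N\sin(\theta_j-\theta_i),\quad \theta_i(0)=\theta_i^0,\ \dot\theta_i(0)=\omega_i^0,\quad i\in[N].$$ The first-order Kuramoto Cauchy problem is $$\dot\theta_i=\nu_i+\frac{\kappa}{N}\sum_{j=1}^N\sin(\theta_j-\theta_i),\quad \theta_i(0)=\theta_i^0,\quad i\in[N].$$ Both have unique global real-analytic solutions. The superscript $(n)$ denotes the $n$-th derivative in $t$. Convergence in the Fréchet topology of $C^0([0,\infty))$ means uniform convergence on every $[0,T]$, $T>0$; convergence in the Fréchet topology of $C^\infty(0,\infty)$ means that the functions and all their $t$-derivatives converge uniformly on every compact interval $[T_1,T_2]\subset(0,\infty)$. *)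

(* Defs.v *)
From Stdlib Require Import Reals.
From Coquelicot Require Import Coquelicot.

Open Scope R_scope.

(* Families indexed by {1, ..., N} are functions on nat of which only the
   values at 0, ..., N - 1 matter.  [sum_n f n] and [Rmax_N f n] range over
   0, ..., n inclusive, hence the [N - 1] (used only with N >= 1). *)

Definition sum_idx (N : nat) (f : nat -> R) : R := sum_n f (N - 1).

Definition max_idx (N : nat) (f : nat -> R) : R := Rmax_N f (N - 1).

(* Differentiation of functions on [0, oo): the difference quotient at t only
   involves points s >= 0, so the derivative at 0 is one-sided and values of
   the function at negative reals are never used.  As with Coquelicot's
   [Derive], [Derive_half] is total and meaningful when [ex_derive_half]. *)

Definition is_derive_half (f : R -> R) (t l : R) : Prop :=
  filterlim (fun s => (f s - f t) / (s - t))
            (within (fun s => 0 <= s) (locally' t)) (locally l).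

Definition ex_derive_half (f : R -> R) (t : R) : Prop :=
  exists l, is_derive_half f t l.

Definition Derive_half (f : R -> R) (t : R) : R :=
  iota (fun l : R => is_derive_half f t l).

Fixpoint Derive_n_half (f : R -> R) (n : nat) : R -> R :=
  match n with
  | O => f
  | S k => Derive_half (Derive_n_half f k)
  end.

Definition smooth_half (f : R -> R) : Prop :=
  forall (n : nat) (t : R), 0 <= t -> ex_derive_half (Derive_n_half f n) t.

Definition kuramoto_force (N : nat) (nu : nat -> R) (kappa : R)
    (x : nat -> R) (i : nat) : R :=
  nu i + kappa / INR N * sum_idx N (fun j => sin (x j - x i)).

Definition inertial_kuramoto_solution (N : nat) (nu : nat -> R)
    (kappa m : R) (theta0 omega0 : nat -> R) (theta : nat -> R -> R) : Prop :=
  forall i : nat, (i < N)%nat ->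
    theta i 0 = theta0 i /\
    Derive_half (theta i) 0 = omega0 i /\
    forall t : R, 0 <= t ->
      ex_derive_half (theta i) t /\
      ex_derive_half (Derive_half (theta i)) t /\
      m * Derive_n_half (theta i) 2 t + Derive_half (theta i) t
        = kuramoto_force N nu kappa (fun j => theta j t) i.

Definition kuramoto_solution (N : nat) (nu : nat -> R)
    (kappa : R) (theta0 : nat -> R) (theta : nat -> R -> R) : Prop :=
  forall i : nat, (i < N)%nat ->
    theta i 0 = theta0 i /\
    forall t : R, 0 <= t ->
      ex_derive_half (theta i) t /\
      Derive_half (theta i) t
        = kuramoto_force N nu kappa (fun j => theta j t) i.

Definition unif_cvg_0right (F : R -> R -> R) (f : R -> R) (a b : R) : Prop :=
  forall eps : R, 0 < eps ->
    at_right 0 (fun m => forall t : R, a <= t <= b -> Rabs (F m t - f t) < eps).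

Definition cvg_C0_half (F : R -> R -> R) (f : R -> R) : Prop :=
  forall T : R, 0 < T -> unif_cvg_0right F f 0 T.

(* Membership of the functions in C^oo(0, oo) is part of the convergence. *)
Definition smooth_pos (f : R -> R) : Prop :=
  forall (n : nat) (t : R), 0 < t -> ex_derive_n f n t.

Definition cvg_Cinf_pos (F : R -> R -> R) (f : R -> R) : Prop :=
  (forall m : R, 0 < m -> smooth_pos (F m)) /\ smooth_pos f /\
  forall (n : nat) (T1 T2 : R), 0 < T1 -> T1 <= T2 ->
    unif_cvg_0right (fun m => Derive_n (F m) n) (Derive_n f n) T1 T2.

(* Main.v *)
Require Import Defs.
From Stdlib Require Import Reals Factorial Lra Lia.
From Coquelicot Require Import Coquelicot.
Open Scope R_scope.

(** Convergence in C^0: [theta_i(m) + m theta_i'(m) - theta_i(0)] has a difference of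
    two couplings as derivative and [|m (theta_i' - omega_i^0)|] is controlled by
    solving the linear equation for [theta_i' - nu_i], so Gronwall gives the estimate.

    Derivatives: if [x'] is majorized by [B / (1 - B z)] then [sin x] is majorized by
    [1 / (1 - B z)].  Hence, with [A = kappa + max |omega^0| + max |nu| + 1 / m], the
    equation [m theta'' + theta' = F] yields inductively
    [|theta^(n)| <= (n - 1)! 2^(n - 1) A^n], and the couplings have n-th derivative
    at most [kappa n! (2 A)^n].  As [m A >= 1], [kappa] is at most
    [A * m kappa e^(2 kappa t)], so the recursion for the derivatives of the difference
    closes without any cancellation between the couplings.

    That estimate blows up as [m -> 0].  Convergence in C^oo comes instead from bounds on
    [theta^(n)] over [[T, oo)] that are uniform in [m <= 1] (the initial layer contributes
    [m^(-n) e^(- T / 2 m)]), interpolated with the C^0 convergence. *)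

(** * Derivatives on the half-line *)

Lemma is_derive_half_eps (f : R -> R) (t l : R) :
  is_derive_half f t l <->
  forall eps : R, 0 < eps -> exists d : R, 0 < d /\
    forall s : R, 0 <= s -> s <> t -> Rabs (s - t) < d ->
      Rabs ((f s - f t) / (s - t) - l) < eps.
Proof.
  split.
  - intros H eps Heps.
    destruct (H (fun y => Rabs (y - l) < eps)) as [d Hd].
    { exists (mkposreal eps Heps); intros y Hy; exact Hy. }
    exists d; split; [apply cond_pos|].
    intros s Hs Hst Hsd; exact (Hd s Hsd Hst Hs).
  - intros H P [eps HP].
    destruct (H eps (cond_pos eps)) as [d [Hd Hf]].
    exists (mkposreal d Hd); intros s Hsd Hst Hs.
    apply HP; exact (Hf s Hs Hst Hsd).
Qed.

(* The extension of [f] beyond 0 is the affine function with slope [l]. *)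
Lemma is_derive_half_extend (f : R -> R) (t l : R) : 0 <= t ->
  (is_derive_half f t l <->
   exists g, (forall s, 0 <= s -> g s = f s) /\ is_derive g t l).
Proof.
  intros Ht; split.
  - intros H; rewrite is_derive_half_eps in H.
    exists (fun s => if Rle_dec 0 s then f s else f t + l * (s - t)); split.
    { intros s Hs; destruct (Rle_dec 0 s); [reflexivity|lra]. }
    apply is_derive_Reals; intros eps Heps.
    destruct (H eps Heps) as [d [Hd Hf]].
    exists (mkposreal d Hd); intros h Hh Hhd; simpl in Hhd.
    destruct (Rle_dec 0 t) as [_|]; [|lra].
    destruct (Rle_dec 0 (t + h)) as [Hth|Hth].
    + replace h with (t + h - t) at 2 by ring.
      apply Hf; [assumption|lra|]. now replace (t + h - t) with h by ring.
    + replace ((f t + l * (t + h - t) - f t) / h - l) with 0 by now field.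
      now rewrite Rabs_R0.
  - intros [g [Hg Hd]]; rewrite is_derive_half_eps; intros eps Heps.
    apply is_derive_Reals in Hd.
    destruct (Hd eps Heps) as [d Hd'].
    exists d; split; [apply cond_pos|]; intros s Hs Hst Hsd.
    rewrite <- (Hg s Hs), <- (Hg t Ht).
    replace (g s) with (g (t + (s - t))) by (f_equal; ring).
    apply Hd'; [lra|assumption].
Qed.

Lemma is_derive_half_interior (f : R -> R) (t l : R) : 0 < t ->
  (is_derive_half f t l <-> is_derive f t l).
Proof.
  intros Ht; rewrite is_derive_half_extend by lra; split.
  - intros [g [Hg Hd]]; apply (is_derive_ext_loc g); [|exact Hd].
    exists (mkposreal t Ht); intros s Hs.
    apply Hg. apply Rabs_lt_between' in Hs; simpl in Hs; lra.
  - intros Hd; exists f; split; [reflexivity|exact Hd].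
Qed.

(** The restricted filter is proper even at [t = 0]: the point [t + d / 2] lies in the
    neighbourhood, differs from [t] and is nonnegative. *)
Lemma is_derive_half_unique (f : R -> R) (t l1 l2 : R) : 0 <= t ->
  is_derive_half f t l1 -> is_derive_half f t l2 -> l1 = l2.
Proof.
  intros Ht H1 H2.
  refine (filterlim_locally_unique _ l1 l2 H1 H2).
  constructor.
  - intros [d Hd].
    assert (Hd0 := cond_pos d).
    assert (E : Rabs (t + d / 2 - t) < d).
    { replace (t + d / 2 - t) with (d / 2) by ring. rewrite Rabs_pos_eq; lra. }
    apply (Hd (t + d / 2) E); lra.
  - apply within_filter, within_filter, locally_filter.
Qed.

Lemma Derive_half_correct (f : R -> R) (t : R) : 0 <= t ->
  ex_derive_half f t -> is_derive_half f t (Derive_half f t).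
Proof.
  intros Ht [l Hl]; unfold Derive_half.
  apply (iota_correct (V := R_CompleteNormedModule)).
  exists l; split; [exact Hl|].
  intros y Hy; exact (is_derive_half_unique f t l y Ht Hl Hy).
Qed.

Lemma Derive_half_eq (f : R -> R) (t l : R) : 0 <= t ->
  is_derive_half f t l -> Derive_half f t = l.
Proof.
  intros Ht Hl; apply (is_derive_half_unique f t _ _ Ht); [|exact Hl].
  apply Derive_half_correct; [exact Ht|now exists l].
Qed.

Lemma is_derive_half_ext (f g : R -> R) (t l : R) : 0 <= t ->
  (forall s, 0 <= s -> f s = g s) ->
  is_derive_half f t l -> is_derive_half g t l.
Proof.
  intros Ht E; rewrite !is_derive_half_extend by assumption.
  intros [h [Hh Hd]]; exists h; split; [|exact Hd].
  intros s Hs; rewrite <- E; auto.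
Qed.

Lemma is_derive_half_const (v t : R) : 0 <= t ->
  is_derive_half (fun _ => v) t 0.
Proof.
  intros Ht; apply is_derive_half_extend; [exact Ht|].
  exists (fun _ => v); split; [reflexivity|apply (is_derive_const (V := R_NormedModule))].
Qed.

Lemma is_derive_half_plus (f g : R -> R) (t l k : R) : 0 <= t ->
  is_derive_half f t l -> is_derive_half g t k ->
  is_derive_half (fun s => f s + g s) t (l + k).
Proof.
  intros Ht; rewrite !is_derive_half_extend by assumption.
  intros [f1 [Hf Df]] [g1 [Hg Dg]]; exists (fun s => f1 s + g1 s); split.
  - intros s Hs; rewrite Hf, Hg; auto.
  - exact (is_derive_plus (V := R_NormedModule) f1 g1 t l k Df Dg).
Qed.

Lemma is_derive_half_mult (f g : R -> R) (t l k : R) : 0 <= t ->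
  is_derive_half f t l -> is_derive_half g t k ->
  is_derive_half (fun s => f s * g s) t (l * g t + f t * k).
Proof.
  intros Ht; rewrite !is_derive_half_extend by assumption.
  intros [f1 [Hf Df]] [g1 [Hg Dg]]; exists (fun s => f1 s * g1 s); split.
  - intros s Hs; rewrite Hf, Hg; auto.
  - rewrite <- (Hf t Ht), <- (Hg t Ht).
    exact (is_derive_mult f1 g1 t l k Df Dg Rmult_comm).
Qed.

Lemma is_derive_half_comp (h f : R -> R) (t k l : R) : 0 <= t ->
  is_derive h (f t) k -> is_derive_half f t l ->
  is_derive_half (fun s => h (f s)) t (k * l).
Proof.
  intros Ht Dh; rewrite !is_derive_half_extend by assumption.
  intros [f1 [Hf Df]]; exists (fun s => h (f1 s)); split.
  - intros s Hs; rewrite Hf; auto.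
  - rewrite Rmult_comm; apply (is_derive_comp (V := R_NormedModule) h f1);
      [rewrite Hf; auto|exact Df].
Qed.

Lemma is_derive_half_scal (v : R) (f : R -> R) (t l : R) : 0 <= t ->
  is_derive_half f t l -> is_derive_half (fun s => v * f s) t (v * l).
Proof.
  intros Ht H.
  replace (v * l) with (0 * f t + v * l) by ring.
  apply (is_derive_half_mult (fun _ => v)); auto.
  now apply is_derive_half_const.
Qed.

Lemma is_derive_half_minus (f g : R -> R) (t l k : R) : 0 <= t ->
  is_derive_half f t l -> is_derive_half g t k ->
  is_derive_half (fun s => f s - g s) t (l - k).
Proof.
  intros Ht Df Dg.
  replace (l - k) with (l + -1 * k) by ring.
  apply (is_derive_half_ext (fun s => f s + -1 * g s)); [exact Ht|intros; ring|].
  apply is_derive_half_plus; auto. now apply is_derive_half_scal.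
Qed.

Lemma Derive_half_ext (f g : R -> R) (t : R) : 0 <= t ->
  (forall s, 0 <= s -> f s = g s) -> ex_derive_half f t ->
  Derive_half f t = Derive_half g t.
Proof.
  intros Ht E Ex; symmetry; apply Derive_half_eq; [exact Ht|].
  apply (is_derive_half_ext f); auto. now apply Derive_half_correct.
Qed.

Lemma Derive_n_half_shift (f : R -> R) (n : nat) :
  Derive_n_half (Derive_half f) n = Derive_n_half f (S n).
Proof.
  induction n as [|n IH]; [reflexivity|].
  simpl; now rewrite IH.
Qed.

Lemma is_derive_Derive_n_half (f : R -> R) (n : nat) (t : R) :
  smooth_half f -> 0 <= t ->
  is_derive_half (Derive_n_half f n) t (Derive_n_half f (S n) t).
Proof. intros Hf Ht; apply Derive_half_correct; auto. Qed.

(** * Mean value estimates on the half-line *)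

Lemma MVT_half (f f' : R -> R) (a b : R) : 0 <= a -> a <= b ->
  (forall s, a <= s -> is_derive_half f s (f' s)) ->
  exists c, a <= c <= b /\ f b - f a = f' c * (b - a).
Proof.
  intros Ha Hab H.
  (* Clamping at [a]: [MVT_gen] asks for two-sided continuity at the endpoint [a], which [f] may
     lack when [a = 0]. The clamped [g] has it and agrees with [f] from [a] on. *)
  set (g := fun s => f (Rmax a s)).
  assert (Gg : forall s, a <= s -> g s = f s).
  { intros s Hs; unfold g; now rewrite Rmax_right. }
  destruct (MVT_gen g a b f') as [c [Hc E]].
  - rewrite Rmin_left, Rmax_right by assumption; intros x Hx.
    apply (is_derive_ext_loc f).
    + assert (Hd : 0 < x - a) by lra.
      exists (mkposreal _ Hd); intros s Hs.
      apply Rabs_lt_between' in Hs; simpl in Hs; symmetry; apply Gg; lra.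
    + apply is_derive_half_interior; [lra|apply H; lra].
  - rewrite Rmin_left, Rmax_right by assumption; intros x Hx.
    destruct (proj1 (is_derive_half_extend f x (f' x) ltac:(lra)) (H x ltac:(lra)))
      as [f1 [Hf1 Df1]].
    assert (Cf : continuity_pt f1 x).
    { apply derivable_continuous_pt; exists (f' x); now apply is_derive_Reals. }
    intros eps Heps; destruct (Cf eps Heps) as [d [Hd Hc]].
    exists d; split; [exact Hd|]; intros s [_ Hs].
    unfold g; rewrite (Rmax_right a x) by lra.
    rewrite <- (Hf1 x) by lra; rewrite <- Hf1 by (generalize (Rmax_l a s); lra).
    destruct (Req_dec (Rmax a s) x) as [->|Hn].
    + unfold dist; simpl; rewrite R_dist_eq; lra.
    + apply Hc; split; [split; [exact I|auto]|].
      unfold dist in *; simpl in *; unfold R_dist in *.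
      (* Clamping does not increase the distance to a point [x >= a]. *)
      eapply Rle_lt_trans; [|exact Hs].
      unfold Rmax; destruct (Rle_dec a s); [lra|].
      unfold Rabs; repeat destruct Rcase_abs; lra.
  - rewrite Rmin_left, Rmax_right in Hc by assumption.
    exists c; split; [exact Hc|]. now rewrite <- !Gg by lra.
Qed.

Lemma derive_half_le (f g f' g' : R -> R) (a b : R) : 0 <= a -> a <= b ->
  (forall s, a <= s -> is_derive_half f s (f' s)) ->
  (forall s, a <= s -> is_derive_half g s (g' s)) ->
  (forall s, a <= s -> f' s <= g' s) ->
  f b - f a <= g b - g a.
Proof.
  intros Ha Hab Df Dg Hle.
  destruct (MVT_half (fun s => g s - f s) (fun s => g' s - f' s) a b)
    as [c [Hc E]]; auto.
  { intros s Hs; apply is_derive_half_minus; [lra|auto|auto]. }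
  assert (0 <= (g' c - f' c) * (b - a)).
  { apply Rmult_le_pos; [|lra]. specialize (Hle c); lra. }
  lra.
Qed.

Lemma derive_half_abs_le (f g f' g' : R -> R) (a b : R) : 0 <= a -> a <= b ->
  (forall s, a <= s -> is_derive_half f s (f' s)) ->
  (forall s, a <= s -> is_derive_half g s (g' s)) ->
  (forall s, a <= s -> Rabs (f' s) <= g' s) ->
  Rabs (f b - f a) <= g b - g a.
Proof.
  intros Ha Hab Df Dg Hle.
  assert (H1 : f b - f a <= g b - g a).
  { apply (derive_half_le f g f' g'); auto.
    intros s Hs; eapply Rle_trans; [apply Rle_abs|auto]. }
  assert (H2 : -1 * f b - -1 * f a <= g b - g a).
  { apply (derive_half_le (fun s => -1 * f s) g (fun s => -1 * f' s) g'); auto.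
    - intros s Hs; apply is_derive_half_scal; [lra|auto].
    - intros s Hs; specialize (Hle s Hs).
      generalize (Rabs_maj2 (f' s)); lra. }
  apply Rabs_le; lra.
Qed.

(** A point [t > 0] has a neighbourhood inside the open half-line, where both notions of derivative
    agree, so the iterates can be compared order by order. This links C^oo convergence, phrased with
    [Derive_n], to the half-line calculus. *)
Lemma Derive_n_half_interior (f : R -> R) : smooth_half f ->
  forall (n : nat) (t : R), 0 < t ->
  ex_derive_n f n t /\ Derive_n f n t = Derive_n_half f n t.
Proof.
  intros Hf.
  assert (E : forall n t, 0 < t -> Derive_n f n t = Derive_n_half f n t).
  { induction n as [|n IH]; intros t Ht; [reflexivity|].
    simpl Derive_n; apply is_derive_unique.
    apply (is_derive_ext_loc (Derive_n_half f n)).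
    - exists (mkposreal t Ht); intros s Hs.
      apply Rabs_lt_between' in Hs; simpl in Hs; symmetry; apply IH; lra.
    - apply is_derive_half_interior; [exact Ht|].
      apply is_derive_Derive_n_half; [exact Hf|lra]. }
  intros n t Ht; split; [|auto].
  destruct n as [|n]; [exact I|].
  exists (Derive_n_half f (S n) t).
  apply (is_derive_ext_loc (Derive_n_half f n)).
  - exists (mkposreal t Ht); intros s Hs.
    apply Rabs_lt_between' in Hs; simpl in Hs; symmetry; apply E; lra.
  - apply is_derive_half_interior; [exact Ht|].
    apply is_derive_Derive_n_half; [exact Hf|lra].
Qed.

(** * Majorized derivatives *)

(* On [a, oo), the derivatives of [f] up to order [k] are dominated by those of
   the majorant [c * (1 - B z) ^ (- p)] at [z = 0]:
   [|f^(l)| <= c * p (p + 1) ... (p + l - 1) * B ^ l].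
   In this form the class is stable under products ([p] adds up), which avoids
   the Leibniz formula. *)
Fixpoint jet (a B : R) (k : nat) (p c : R) (f : R -> R) : Prop :=
  (forall t, 0 <= t -> a <= t -> Rabs (f t) <= c) /\
  match k with
  | O => True
  | S k' => (forall t, 0 <= t -> ex_derive_half f t) /\
            jet a B k' (p + 1) (c * p * B) (Derive_half f)
  end.

Lemma jet_ext a B k p c f g : (forall t, 0 <= t -> f t = g t) ->
  jet a B k p c f -> jet a B k p c g.
Proof.
  revert p c f g; induction k as [|k IH]; intros p c f g E [Hb Hk]; split; auto.
  - intros t Ht Hat; rewrite <- E; auto.
  - intros t Ht Hat; rewrite <- E; auto.
  - destruct Hk as [Hex Hk]; split.
    + intros t Ht; destruct (Hex t Ht) as [l Hl]; exists l.
      now apply (is_derive_half_ext f).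
    + apply (IH _ _ (Derive_half f)); [|exact Hk].
      intros t Ht; apply Derive_half_ext; auto.
Qed.

Lemma jet_le a B k p c p' c' f : 0 <= B -> 0 <= p <= p' -> 0 <= c <= c' ->
  jet a B k p c f -> jet a B k p' c' f.
Proof.
  revert p c p' c' f; induction k as [|k IH]; intros p c p' c' f HB Hp Hc [Hb Hk].
  - split; [|exact I]. intros t Ht Hat; specialize (Hb t Ht Hat); lra.
  - destruct Hk as [Hex Hk]; split; [|split; [exact Hex|]].
    + intros t Ht Hat; specialize (Hb t Ht Hat); lra.
    + apply (IH (p + 1) (c * p * B)); [exact HB|lra| |exact Hk].
      assert (0 <= c * p) by (apply Rmult_le_pos; lra).
      assert (c * p <= c' * p') by (apply Rmult_le_compat; lra).
      split; [apply Rmult_le_pos; lra|apply Rmult_le_compat_r; lra].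
Qed.

Lemma jet_pred a B k p c f : jet a B (S k) p c f -> jet a B k p c f.
Proof.
  revert p c f; induction k as [|k IH]; intros p c f [Hb [Hex Hk]].
  - split; [exact Hb|exact I].
  - split; [exact Hb|split; [exact Hex|apply IH; exact Hk]].
Qed.

(** By uniqueness of the derivative, an explicit formula [f'] may stand in for [Derive_half f] in
    the inductions. *)
Lemma jet_S_intro a B k p c f f' :
  (forall t, 0 <= t -> a <= t -> Rabs (f t) <= c) ->
  (forall t, 0 <= t -> is_derive_half f t (f' t)) ->
  jet a B k (p + 1) (c * p * B) f' -> jet a B (S k) p c f.
Proof.
  intros Hb Hd Hk; split; [exact Hb|split].
  - intros t Ht; exists (f' t); auto.
  - apply (jet_ext _ _ _ _ _ f'); [|exact Hk].
    intros t Ht; symmetry; apply Derive_half_eq; auto.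
Qed.

Lemma jet_S_derive a B k p c f t : jet a B (S k) p c f -> 0 <= t ->
  is_derive_half f t (Derive_half f t).
Proof. intros [_ [Hex _]] Ht; apply Derive_half_correct; auto. Qed.

(** Vanishing derivatives fit every exponent. The case [p = 0] is the one that lets a scalar factor
    leave the exponent of a product unchanged. *)
Lemma jet_const a B k p c v : 0 <= B -> 0 <= p -> Rabs v <= c ->
  jet a B k p c (fun _ => v).
Proof.
  revert p c v; induction k as [|k IH]; intros p c v HB Hp Hv.
  - split; auto.
  - apply (jet_S_intro _ _ _ _ _ _ (fun _ => 0)); auto.
    + intros; now apply is_derive_half_const.
    + apply IH; [exact HB|lra|]. rewrite Rabs_R0.
      generalize (Rabs_pos v); intros.
      repeat apply Rmult_le_pos; lra.
Qed.

Lemma jet_plus a B k p c d f g :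
  jet a B k p c f -> jet a B k p d g -> jet a B k p (c + d) (fun t => f t + g t).
Proof.
  revert p c d f g; induction k as [|k IH]; intros p c d f g Hf Hg.
  - destruct Hf as [Hf _], Hg as [Hg _]; split; [|exact I].
    intros t Ht Hat; specialize (Hf t Ht Hat); specialize (Hg t Ht Hat).
    generalize (Rabs_triang (f t) (g t)); lra.
  - apply (jet_S_intro _ _ _ _ _ _ (fun t => Derive_half f t + Derive_half g t)).
    + destruct Hf as [Hf _], Hg as [Hg _].
      intros t Ht Hat; specialize (Hf t Ht Hat); specialize (Hg t Ht Hat).
      generalize (Rabs_triang (f t) (g t)); lra.
    + intros t Ht; apply is_derive_half_plus; auto;
        eapply jet_S_derive; eassumption.
    + replace ((c + d) * p * B) with (c * p * B + d * p * B) by ring.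
      apply IH; [apply Hf|apply Hg].
Qed.

(** The two terms of the product rule have constants [c * p * B * d] and [c * (d * q * B)], which
    add up to [c * d * (p + q) * B], and both have exponent [p + q + 1]. The undifferentiated factor
    is lowered to order [k] by [jet_pred]. *)
Lemma jet_mult a B k p q c d f g :
  jet a B k p c f -> jet a B k q d g ->
  jet a B k (p + q) (c * d) (fun t => f t * g t).
Proof.
  revert p q c d f g; induction k as [|k IH]; intros p q c d f g Hf Hg.
  - destruct Hf as [Hf _], Hg as [Hg _]; split; [|exact I].
    intros t Ht Hat; rewrite Rabs_mult.
    apply Rmult_le_compat; auto using Rabs_pos.
  - apply (jet_S_intro _ _ _ _ _ _
             (fun t => Derive_half f t * g t + f t * Derive_half g t)).
    + destruct Hf as [Hf _], Hg as [Hg _].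
      intros t Ht Hat; rewrite Rabs_mult.
      apply Rmult_le_compat; auto using Rabs_pos.
    + intros t Ht; apply is_derive_half_mult; auto;
        eapply jet_S_derive; eassumption.
    + replace (c * d * (p + q) * B) with (c * p * B * d + c * (d * q * B)) by ring.
      apply jet_plus.
      * replace (p + q + 1) with (p + 1 + q) by ring.
        apply IH; [apply Hf|apply jet_pred; exact Hg].
      * replace (p + q + 1) with (p + (q + 1)) by ring.
        apply IH; [apply jet_pred; exact Hf|apply Hg].
Qed.

Lemma jet_scal a B k p c v f : 0 <= B ->
  jet a B k p c f -> jet a B k p (Rabs v * c) (fun t => v * f t).
Proof.
  intros HB Hf.
  replace p with (0 + p) by ring.
  apply (jet_mult _ _ _ _ _ _ _ (fun _ => v)); [|exact Hf].
  apply jet_const; lra.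
Qed.

Lemma jet_minus a B k p c d f g : 0 <= B ->
  jet a B k p c f -> jet a B k p d g -> jet a B k p (c + d) (fun t => f t - g t).
Proof.
  intros HB Hf Hg.
  apply (jet_ext _ _ _ _ _ (fun t => f t + -1 * g t)); [intros; ring|].
  apply jet_plus; [exact Hf|].
  replace d with (Rabs (-1) * d); [now apply jet_scal|].
  rewrite Rabs_left; lra.
Qed.

Lemma jet_sum a B k p c (f : nat -> R -> R) n :
  (forall j, (j <= n)%nat -> jet a B k p c (f j)) ->
  jet a B k p (INR (S n) * c) (fun t => sum_n (fun j => f j t) n).
Proof.
  induction n as [|n IH]; intros Hf.
  - replace (INR 1 * c) with c by (simpl; ring).
    apply (jet_ext _ _ _ _ _ (f 0%nat)); [|auto].
    intros t _; now rewrite sum_O.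
  - apply (jet_ext _ _ _ _ _ (fun t => sum_n (fun j => f j t) n + f (S n) t)).
    { intros t _; now rewrite sum_Sn. }
    replace (INR (S (S n)) * c) with (INR (S n) * c + c) by (rewrite (S_INR (S n)); ring).
    apply jet_plus; auto.
Qed.

Lemma Rabs_sin_le_1 (x : R) : Rabs (sin x) <= 1.
Proof. apply Rabs_le; generalize (SIN_bound x); lra. Qed.

Lemma Rabs_cos_le_1 (x : R) : Rabs (cos x) <= 1.
Proof. apply Rabs_le; generalize (COS_bound x); lra. Qed.

(* [(1 - B z) ^ (-1)] reproduces itself: [(sin x)' = cos x * x'] has
   majorant [(1 - B z) ^ (-1) * B (1 - B z) ^ (-1)]. *)
Lemma jet_sin_cos a B k x : 0 <= B ->
  (forall t, 0 <= t -> ex_derive_half x t) ->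
  jet a B k 1 B (Derive_half x) ->
  jet a B (S k) 1 1 (fun t => sin (x t)) /\ jet a B (S k) 1 1 (fun t => cos (x t)).
Proof.
  intros HB Hex; induction k as [|k IH]; intros Hx.
  - assert (H0 : forall f, (forall y, Rabs (f y) <= 1) ->
      jet a B 0 1 1 (fun t => f (x t))) by (intros f Hf; split; auto).
    split.
    + apply (jet_S_intro _ _ _ _ _ _ (fun t => cos (x t) * Derive_half x t)).
      * auto using Rabs_sin_le_1.
      * intros t Ht; apply is_derive_half_comp;
          auto using is_derive_sin, Derive_half_correct.
      * rewrite 2!Rmult_1_l; replace B with (1 * B) at 2 by ring.
        apply jet_mult; auto using Rabs_cos_le_1.
    + apply (jet_S_intro _ _ _ _ _ _ (fun t => - sin (x t) * Derive_half x t)).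
      * auto using Rabs_cos_le_1.
      * intros t Ht; apply (is_derive_half_comp cos);
          auto using is_derive_cos, Derive_half_correct.
      * rewrite 2!Rmult_1_l; replace B with (1 * B) at 2 by ring.
        apply jet_mult; auto.
        apply (H0 (fun y => - sin y)); intros y; rewrite Rabs_Ropp; apply Rabs_sin_le_1.
  - destruct (IH (jet_pred _ _ _ _ _ _ Hx)) as [Hs Hc]; split.
    + apply (jet_S_intro _ _ _ _ _ _ (fun t => cos (x t) * Derive_half x t)).
      * auto using Rabs_sin_le_1.
      * intros t Ht; apply is_derive_half_comp;
          auto using is_derive_sin, Derive_half_correct.
      * rewrite 2!Rmult_1_l; replace B with (1 * B) at 2 by ring.
        now apply jet_mult.
    + apply (jet_S_intro _ _ _ _ _ _ (fun t => - sin (x t) * Derive_half x t)).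
      * auto using Rabs_cos_le_1.
      * intros t Ht; apply (is_derive_half_comp cos);
          auto using is_derive_cos, Derive_half_correct.
      * rewrite 2!Rmult_1_l; replace B with (1 * B) at 2 by ring.
        apply jet_mult; auto.
        apply (jet_ext _ _ _ _ _ (fun t => -1 * sin (x t))); [intros; ring|].
        replace 1 with (Rabs (-1) * 1) at 2 by (rewrite Rabs_left; lra).
        now apply jet_scal.
Qed.

(** The exponent is a general [q + 1] because each derivative raises it by one; at integers the
    rising factorial [(q + 1) ... (q + l)] is [(q + l)! / q!]. *)
Lemma jet_Derive_n_half a B q c f k l : jet a B k (INR q + 1) c f -> (l <= k)%nat ->
  (forall t, 0 <= t -> a <= t ->
     Rabs (Derive_n_half f l t) <= c * INR (fact (q + l)) / INR (fact q) * B ^ l) /\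
  ((l < k)%nat -> forall t, 0 <= t -> ex_derive_half (Derive_n_half f l) t).
Proof.
  revert q c f k; induction l as [|l IH]; intros q c f k Hf Hl.
  - assert (F := INR_fact_neq_0 q).
    rewrite Nat.add_0_r; simpl Derive_n_half; split.
    + intros t Ht Hat; replace (c * _ / _ * _) with c by (simpl; field; auto).
      destruct k; apply Hf; auto.
    + destruct k; [lia|intros _; apply Hf].
  - destruct k as [|k]; [lia|].
    destruct Hf as [_ [_ Hf]].
    rewrite <- S_INR in Hf.
    destruct (IH (S q) _ _ k Hf) as [H1 H2]; [lia|].
    rewrite Derive_n_half_shift in H1, H2; split; [|intros; apply H2; auto; lia].
    intros t Ht Hat; eapply Rle_trans; [apply H1; auto|apply Req_le].
    replace (S q + l)%nat with (q + S l)%nat by lia.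
    rewrite (fact_simpl q), mult_INR.
    assert (F := INR_fact_neq_0 q); assert (F' := not_0_INR (S q)).
    simpl (B ^ S l); field; auto.
Qed.

Lemma jet_1_Derive_n_half a B c f n t : jet a B n 1 c f -> 0 <= t -> a <= t ->
  Rabs (Derive_n_half f n t) <= c * INR (fact n) * B ^ n.
Proof.
  intros Hf Ht Hat.
  destruct (jet_Derive_n_half a B 0 c f n n) as [H _]; auto.
  { replace (INR 0 + 1) with 1 by (simpl; ring); exact Hf. }
  specialize (H t Ht Hat); simpl in H; now rewrite Rdiv_1_r in H.
Qed.

Lemma jet_smooth_half a B c f : (forall k, jet a B k 1 c f) -> smooth_half f.
Proof.
  intros Hf n t Ht.
  destruct (jet_Derive_n_half a B 0 c f (S n) n) as [_ H]; auto.
  replace (INR 0 + 1) with 1 by (simpl; ring); apply Hf.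
Qed.

(** Converse of [jet_Derive_n_half]: explicit factorial bounds from time [a] on become a majorant,
    the form that products and sines accept. *)
Lemma jet_intro a B q c f k : smooth_half f ->
  (forall l, (l <= k)%nat -> forall t, 0 <= t -> a <= t ->
     Rabs (Derive_n_half f l t) <= c * INR (fact (q + l)) / INR (fact q) * B ^ l) ->
  jet a B k (INR q + 1) c f.
Proof.
  revert q c f; induction k as [|k IH]; intros q c f Hs Hb.
  - split; [|exact I]; intros t Ht Hat.
    specialize (Hb 0%nat (le_n _) t Ht Hat); simpl in Hb; rewrite Nat.add_0_r in Hb.
    replace c with (c * INR (fact q) / INR (fact q) * 1); [exact Hb|].
    field; apply INR_fact_neq_0.
  - split; [|split].
    + intros t Ht Hat.
      specialize (Hb 0%nat (Nat.le_0_l _) t Ht Hat); simpl in Hb; rewrite Nat.add_0_r in Hb.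
      replace c with (c * INR (fact q) / INR (fact q) * 1); [exact Hb|].
      field; apply INR_fact_neq_0.
    + exact (Hs 0%nat).
    + rewrite <- S_INR; apply IH.
      * intros n; rewrite Derive_n_half_shift; apply (Hs (S n)).
      * intros l Hl t Ht Hat; rewrite Derive_n_half_shift.
        eapply Rle_trans; [apply Hb; auto; lia|apply Req_le].
        replace (S q + l)%nat with (q + S l)%nat by lia.
        rewrite (fact_simpl q), mult_INR.
        assert (F := INR_fact_neq_0 q); assert (F' := not_0_INR (S q)).
        simpl (B ^ S l); field; auto.
Qed.

(** * Kuramoto solutions *)

(** The interaction part of [kuramoto_force], isolated because it is bounded by [kappa] whatever
    [nu] is, and because [nu] disappears on differentiating in time. *)
Definition coupling (N : nat) (kappa : R) (x : nat -> R) (i : nat) : R :=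
  kappa / INR N * sum_idx N (fun j => sin (x j - x i)).

Lemma Rmax_N_ge (f : nat -> R) (n j : nat) : (j <= n)%nat -> f j <= Rmax_N f n.
Proof.
  induction n as [|n IH]; intros Hj; simpl.
  - replace j with 0%nat by lia; lra.
  - destruct (Nat.eq_dec j (S n)) as [->|Hn]; [apply Rmax_l|].
    eapply Rle_trans; [apply IH; lia|apply Rmax_r].
Qed.

Lemma max_idx_ge (N : nat) (f : nat -> R) (j : nat) : (j < N)%nat -> f j <= max_idx N f.
Proof. intros Hj; apply Rmax_N_ge; lia. Qed.

Lemma sum_n_dist_le (f g : nat -> R) (c : R) (n : nat) :
  (forall j, (j <= n)%nat -> Rabs (f j - g j) <= c) ->
  Rabs (sum_n f n - sum_n g n) <= INR (S n) * c.
Proof.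
  induction n as [|n IH]; intros H.
  - rewrite !sum_O; simpl; rewrite Rmult_1_l; auto.
  - rewrite !sum_Sn, (S_INR (S n)); unfold plus; simpl (AbelianMonoid.plus _ _ _).
    replace (sum_n f n + f (S n) - (sum_n g n + g (S n)))
      with ((sum_n f n - sum_n g n) + (f (S n) - g (S n))) by ring.
    eapply Rle_trans; [apply Rabs_triang|].
    rewrite Rmult_plus_distr_r, Rmult_1_l; apply Rplus_le_compat; auto.
Qed.

Lemma coupling_dist_le N kappa x y i c : (1 <= N)%nat -> 0 < kappa ->
  (forall j, (j < N)%nat -> Rabs (sin (x j - x i) - sin (y j - y i)) <= c) ->
  Rabs (coupling N kappa x i - coupling N kappa y i) <= kappa * c.
Proof.
  intros HN Hk H; unfold coupling, sum_idx.
  assert (HN' : 0 < INR N) by (apply lt_0_INR; lia).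
  rewrite <- Rmult_minus_distr_l, Rabs_mult.
  rewrite Rabs_pos_eq by (apply Rlt_le, Rdiv_lt_0_compat; assumption).
  replace (kappa * c) with (kappa / INR N * (INR (S (N - 1)) * c)).
  - apply Rmult_le_compat_l; [apply Rlt_le, Rdiv_lt_0_compat; assumption|].
    apply sum_n_dist_le; intros j Hj; apply H; lia.
  - replace (S (N - 1)) with N by lia; field; lra.
Qed.

Lemma sin_dist_le (a b : R) : Rabs (sin a - sin b) <= Rabs (a - b).
Proof.
  destruct (MVT_gen sin b a cos) as [c [_ ->]].
  - intros; apply is_derive_sin.
  - intros; apply continuity_sin.
  - rewrite Rabs_mult; generalize (Rabs_cos_le_1 c) (Rabs_pos (a - b)); nra.
Qed.

(** The factor 2 arises because a perturbation moves both phases, [j] and [i], inside each sine. *)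
Lemma coupling_lipschitz N kappa x y i d : (1 <= N)%nat -> 0 < kappa -> (i < N)%nat ->
  (forall j, (j < N)%nat -> Rabs (x j - y j) <= d) ->
  Rabs (coupling N kappa x i - coupling N kappa y i) <= 2 * kappa * d.
Proof.
  intros HN Hk Hi H.
  replace (2 * kappa * d) with (kappa * (d + d)) by ring.
  apply coupling_dist_le; auto; intros j Hj.
  eapply Rle_trans; [apply sin_dist_le|].
  replace (x j - x i - (y j - y i)) with ((x j - y j) - (x i - y i)) by ring.
  unfold Rminus at 1; eapply Rle_trans; [apply Rabs_triang|].
  rewrite Rabs_Ropp; apply Rplus_le_compat; auto.
Qed.

Lemma coupling_bound N kappa x i : (1 <= N)%nat -> 0 < kappa ->
  Rabs (coupling N kappa x i) <= kappa.
Proof.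
  intros HN Hk.
  (* Comparison with the configuration whose phases are all 0, where the coupling vanishes. *)
  replace (coupling N kappa x i) with (coupling N kappa x i - coupling N kappa (fun _ => 0) i).
  - rewrite <- (Rmult_1_r kappa) at 3; apply coupling_dist_le; auto.
    intros j _; rewrite (Rminus_0_r 0), sin_0, Rminus_0_r; apply Rabs_sin_le_1.
  - unfold coupling, sum_idx at 2.
    rewrite (sum_n_ext _ (fun _ => 0)) by (intros; now rewrite Rminus_0_r, sin_0).
    rewrite sum_n_const; ring.
Qed.

(** Each velocity has constant [B / 2], so a phase difference has constant [B], exactly what
    [jet_sin_cos] requires. This is the origin of the factor 2 in the ratio [2 * A] below. One order
    is gained, since only velocities are assumed bounded. *)
Lemma jet_coupling N kappa (th : nat -> R -> R) i a B k :
  (1 <= N)%nat -> 0 < kappa -> 0 <= B -> (i < N)%nat ->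
  (forall j, (j < N)%nat -> forall t, 0 <= t -> ex_derive_half (th j) t) ->
  (forall j, (j < N)%nat -> jet a B k 1 (B / 2) (Derive_half (th j))) ->
  jet a B (S k) 1 kappa (fun t => coupling N kappa (fun j => th j t) i).
Proof.
  intros HN Hk HB Hi Hex Hj.
  assert (HN' : 0 < INR N) by (apply lt_0_INR; lia).
  replace kappa with (Rabs (kappa / INR N) * (INR (S (N - 1)) * 1)) at 1.
  - apply jet_scal; [exact HB|].
    apply (jet_sum _ _ _ _ _ (fun j t => sin (th j t - th i t))); intros j Hjn.
    assert (HjN : (j < N)%nat) by lia.
    assert (D : forall t, 0 <= t -> is_derive_half (fun s => th j s - th i s) t
                  (Derive_half (th j) t - Derive_half (th i) t)).
    { intros t Ht; apply is_derive_half_minus; auto using Derive_half_correct. }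
    apply jet_sin_cos; [exact HB| |].
    + intros t Ht; eexists; apply D; exact Ht.
    + apply (jet_ext _ _ _ _ _ (fun t => Derive_half (th j) t - Derive_half (th i) t)).
      { intros t Ht; symmetry; apply Derive_half_eq; auto. }
      replace B with (B / 2 + B / 2) at 2 by lra.
      apply jet_minus; auto.
  - rewrite Rabs_pos_eq by (apply Rlt_le, Rdiv_lt_0_compat; assumption).
    replace (S (N - 1)) with N by lia; field; lra.
Qed.

(* Integrating factor [exp (s / m)] for [m u' + u = r] with [|r| <= M]. *)
Lemma relaxation_bound (u u' : R -> R) (m M a t : R) : 0 < m -> 0 <= a -> a <= t -> 0 <= M ->
  (forall s, a <= s -> is_derive_half u s (u' s)) ->
  (forall s, a <= s -> Rabs (m * u' s + u s) <= M) ->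
  Rabs (u t) <= Rabs (u a) * exp (- (t - a) / m) + M.
Proof.
  intros Hm Ha Hat HM Du Hr.
  assert (De : forall s, 0 <= s -> is_derive_half (fun x => exp (x / m)) s (exp (s / m) / m)).
  { intros s Hs; apply is_derive_half_extend; [exact Hs|].
    exists (fun x => exp (x / m)); split; [reflexivity|].
    auto_derive; [exact I|]. unfold Rdiv; ring. }
  assert (H := derive_half_abs_le (fun s => u s * exp (s / m)) (fun s => M * exp (s / m))
    (fun s => u' s * exp (s / m) + u s * (exp (s / m) / m))
    (fun s => M * (exp (s / m) / m)) a t Ha Hat).
  assert (H' : Rabs (u t * exp (t / m) - u a * exp (a / m))
               <= M * exp (t / m) - M * exp (a / m)).
  { apply H.
    - intros s Hs; apply (is_derive_half_mult u (fun x => exp (x / m))); [lra|auto|apply De; lra].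
    - intros s Hs; apply (is_derive_half_scal M (fun x => exp (x / m))); [lra|apply De; lra].
    - intros s Hs.
      replace (u' s * exp (s / m) + u s * (exp (s / m) / m))
        with ((m * u' s + u s) * (exp (s / m) / m)) by (field; lra).
      assert (P : 0 < exp (s / m) / m) by (apply Rdiv_lt_0_compat; [apply exp_pos|lra]).
      rewrite Rabs_mult, (Rabs_pos_eq (exp (s / m) / m)) by lra.
      apply Rmult_le_compat_r; [lra|auto]. }
  replace (- (t - a) / m) with (a / m + - (t / m)) by (field; lra).
  rewrite exp_plus, exp_Ropp.
  assert (Pt := exp_pos (t / m)); assert (Pa := exp_pos (a / m)).
  apply (Rmult_le_reg_r (exp (t / m))); [exact Pt|].
  replace ((Rabs (u a) * (exp (a / m) * / exp (t / m)) + M) * exp (t / m))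
    with (Rabs (u a) * exp (a / m) + M * exp (t / m)) by (field; lra).
  assert (Et : Rabs (u t * exp (t / m)) = Rabs (u t) * exp (t / m))
    by (rewrite Rabs_mult, (Rabs_pos_eq (exp _)); lra).
  assert (Ea : Rabs (u a * exp (a / m)) = Rabs (u a) * exp (a / m))
    by (rewrite Rabs_mult, (Rabs_pos_eq (exp _)); lra).
  rewrite <- Et, <- Ea.
  generalize (Rabs_triang_inv (u t * exp (t / m)) (u a * exp (a / m))).
  assert (0 <= M * exp (a / m)) by (apply Rmult_le_pos; lra).
  lra.
Qed.

(** * A priori bounds along the inertial flow *)

Lemma inertial_derivatives N nu kappa m theta0 omega0 theta i t :
  inertial_kuramoto_solution N nu kappa m theta0 omega0 theta ->
  (i < N)%nat -> 0 <= t ->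
  ex_derive_half (theta i) t /\ ex_derive_half (Derive_half (theta i)) t /\
  m * Derive_half (Derive_half (theta i)) t + Derive_half (theta i) t
    = nu i + coupling N kappa (fun j => theta j t) i.
Proof. intros H Hi Ht; exact (proj2 (proj2 (H i Hi)) t Ht). Qed.

(** Relaxation applied to [theta_i' - v], whose right-hand side is [nu i - v] plus the coupling. The
    shift [v] is left free: [v = 0] bounds the velocity itself, while [v = nu i] removes the drift
    and leaves only [kappa] beside the decaying term. *)
Lemma inertial_velocity_bound N nu kappa m theta0 omega0 theta i v t :
  (1 <= N)%nat -> 0 < kappa -> 0 < m ->
  inertial_kuramoto_solution N nu kappa m theta0 omega0 theta ->
  (i < N)%nat -> 0 <= t ->
  Rabs (Derive_half (theta i) t - v)
    <= Rabs (omega0 i - v) * exp (- t / m) + (Rabs (nu i - v) + kappa).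
Proof.
  intros HN Hk Hm H Hi Ht.
  rewrite <- (proj1 (proj2 (H i Hi))).
  replace (- t / m) with (- (t - 0) / m) by (f_equal; ring).
  apply (relaxation_bound (fun s => Derive_half (theta i) s - v)
           (Derive_half (Derive_half (theta i)))); try lra.
  - generalize (Rabs_pos (nu i - v)); lra.
  - intros s Hs.
    destruct (inertial_derivatives _ _ _ _ _ _ _ i s H Hi Hs) as [_ [Hd _]].
    rewrite <- (Rminus_0_r (Derive_half (Derive_half (theta i)) s)).
    apply (is_derive_half_minus _ (fun _ => v));
      auto using Derive_half_correct, is_derive_half_const.
  - intros s Hs.
    destruct (inertial_derivatives _ _ _ _ _ _ _ i s H Hi Hs) as [_ [_ E]].
    replace (m * Derive_half (Derive_half (theta i)) s + (Derive_half (theta i) s - v))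
      with ((nu i - v) + coupling N kappa (fun j => theta j s) i) by lra.
    eapply Rle_trans; [apply Rabs_triang|].
    apply Rplus_le_compat_l; now apply coupling_bound.
Qed.

Lemma exp_relaxation_le_1 (m t : R) : 0 < m -> 0 <= t -> exp (- t / m) <= 1.
Proof.
  intros Hm Ht; rewrite <- exp_0.
  destruct Ht as [Ht|<-]; [|right; f_equal; field; lra].
  left; apply exp_increasing.
  assert (0 < t / m) by (apply Rdiv_lt_0_compat; lra).
  replace (- t / m) with (- (t / m)) by (field; lra); lra.
Qed.

Lemma inertial_velocity_le N nu kappa m theta0 omega0 theta W V i t :
  (1 <= N)%nat -> 0 < kappa -> 0 < m ->
  inertial_kuramoto_solution N nu kappa m theta0 omega0 theta ->
  (forall j, (j < N)%nat -> Rabs (omega0 j) <= W) ->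
  (forall j, (j < N)%nat -> Rabs (nu j) <= V) ->
  (i < N)%nat -> 0 <= t -> Rabs (Derive_half (theta i) t) <= kappa + W + V.
Proof.
  intros HN Hk Hm H HW HV Hi Ht.
  assert (B := inertial_velocity_bound _ _ _ _ _ _ _ i 0 t HN Hk Hm H Hi Ht).
  rewrite !Rminus_0_r in B.
  specialize (HW i Hi); specialize (HV i Hi).
  generalize (exp_relaxation_le_1 m t Hm Ht) (Rabs_pos (omega0 i)); nra.
Qed.

(** Induction through [theta'' = (nu + coupling - theta') / m]. At each order the right-hand side
    has constant at most [(V + kappa + A) / m <= A * (2 * A)], which is the constant that [jet]
    demands of the derivative; the exponent 1 is then relaxed to 2. *)
Lemma inertial_jet N nu kappa m theta0 omega0 theta W V A :
  (1 <= N)%nat -> 0 < kappa -> 0 < m ->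
  inertial_kuramoto_solution N nu kappa m theta0 omega0 theta ->
  (forall j, (j < N)%nat -> Rabs (omega0 j) <= W) ->
  (forall j, (j < N)%nat -> Rabs (nu j) <= V) ->
  kappa + W + V <= A -> 1 / m <= A ->
  forall k i, (i < N)%nat -> jet 0 (2 * A) k 1 A (Derive_half (theta i)).
Proof.
  intros HN Hk Hm H HW HV HA HmA.
  assert (HW0 := HW 0%nat HN); assert (HV0 := HV 0%nat HN).
  assert (PW := Rabs_pos (omega0 0%nat)); assert (PV := Rabs_pos (nu 0%nat)).
  assert (Hb : forall i t, (i < N)%nat -> 0 <= t -> Rabs (Derive_half (theta i) t) <= A).
  { intros i t Hi Ht; eapply Rle_trans; [|exact HA]; eapply inertial_velocity_le; eauto. }
  induction k as [|k IH]; intros i Hi; [split; auto|].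
  split; [auto|split].
  - intros t Ht; now apply (inertial_derivatives _ _ _ _ _ _ _ i t H Hi).
  - apply (jet_ext _ _ _ _ _ (fun t => / m *
      (nu i + coupling N kappa (fun j => theta j t) i - Derive_half (theta i) t))).
    { intros t Ht.
      rewrite <- (proj2 (proj2 (inertial_derivatives _ _ _ _ _ _ _ i t H Hi Ht))).
      field; lra. }
    assert (Pm : 0 < / m) by now apply Rinv_0_lt_compat.
    apply (jet_le _ _ _ 1 (Rabs (/ m) * (V + kappa + A))); [lra|lra| |].
    + rewrite Rabs_pos_eq by lra; split; [apply Rmult_le_pos; lra|].
      unfold Rdiv in HmA; nra.
    + apply jet_scal; [lra|]; apply jet_minus; [lra| |auto].
      apply jet_plus; [apply jet_const; auto; lra|].
      apply jet_pred, jet_coupling; auto; [lra| |].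
      * intros j Hj t Ht; now apply (inertial_derivatives _ _ _ _ _ _ _ j t H Hj).
      * intros j Hj; replace (2 * A / 2) with A by field; auto.
Qed.

(** * A priori bounds along the first-order flow and distance between the flows *)

Lemma kuramoto_derivatives N nu kappa theta0 theta i t :
  kuramoto_solution N nu kappa theta0 theta ->
  (i < N)%nat -> 0 <= t ->
  ex_derive_half (theta i) t /\
  Derive_half (theta i) t = nu i + coupling N kappa (fun j => theta j t) i.
Proof. intros H Hi Ht; exact (proj2 (H i Hi) t Ht). Qed.

(** The velocity is [nu i] plus the coupling, and the coupling is controlled to one order more than
    the velocities, so the order climbs with the same constant [V + kappa <= A]. *)
Lemma kuramoto_jet N nu kappa theta0 theta V A :
  (1 <= N)%nat -> 0 < kappa ->
  kuramoto_solution N nu kappa theta0 theta ->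
  (forall j, (j < N)%nat -> Rabs (nu j) <= V) ->
  kappa + V <= A ->
  forall k i, (i < N)%nat -> jet 0 (2 * A) k 1 A (Derive_half (theta i)).
Proof.
  intros HN Hk H HV HA.
  assert (HV0 := HV 0%nat HN); assert (PV := Rabs_pos (nu 0%nat)).
  assert (S : forall k i, (i < N)%nat ->
    jet 0 (2 * A) k 1 kappa (fun t => coupling N kappa (fun j => theta j t) i) ->
    jet 0 (2 * A) k 1 A (Derive_half (theta i))).
  { intros k i Hi J.
    apply (jet_ext _ _ _ _ _ (fun t => nu i + coupling N kappa (fun j => theta j t) i)).
    - intros t Ht; symmetry; now apply (kuramoto_derivatives _ _ _ _ _ i t H Hi).
    - apply (jet_le _ _ _ 1 (V + kappa)); [lra..|].
      apply jet_plus; [apply jet_const; auto; lra|exact J]. }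
  induction k as [|k IH]; intros i Hi; apply S; auto.
  - split; auto using coupling_bound.
  - apply jet_coupling; auto; [lra| |].
    + intros j Hj t Ht; now apply (kuramoto_derivatives _ _ _ _ _ j t H Hj).
    + intros j Hj; replace (2 * A / 2) with A by field; auto.
Qed.

Lemma smooth_half_of_jet a B c f : (forall t, 0 <= t -> ex_derive_half f t) ->
  (forall k, jet a B k 1 c (Derive_half f)) -> smooth_half f.
Proof.
  intros H0 Hj [|n] t Ht; [now apply H0|].
  rewrite <- Derive_n_half_shift; now apply (jet_smooth_half a B c).
Qed.

(* Picard iteration: the error term [(2 kappa t) ^ n / n!] starts from the
   trivial bound [2 kappa] on differences of couplings. *)
Lemma kuramoto_distance N nu kappa m theta0 omega0 theta phi Om i t :
  (1 <= N)%nat -> 0 < kappa -> 0 < m ->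
  inertial_kuramoto_solution N nu kappa m theta0 omega0 theta ->
  kuramoto_solution N nu kappa theta0 phi ->
  (forall j, (j < N)%nat -> Rabs (omega0 j - nu j) <= Om) ->
  (i < N)%nat -> 0 <= t ->
  Rabs (theta i t - phi i t) <= m * (2 * Om + kappa) * exp (2 * kappa * t).
Proof.
  intros HN Hk Hm Hth Hphi HOm Hi Ht.
  set (K := m * (2 * Om + kappa)).
  assert (HK : 0 <= K).
  { unfold K; generalize (HOm 0%nat HN) (Rabs_pos (omega0 0%nat - nu 0%nat)); intros.
    apply Rmult_le_pos; lra. }
  set (c := fun j s => coupling N kappa (fun l => theta l s) j
                       - coupling N kappa (fun l => phi l s) j).
  (* An integral inequality in differential form: [g] is a primitive of a common bound on the
     coupling differences of all oscillators. *)
  assert (step : forall (g g' : R -> R),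
    (forall s, 0 <= s -> is_derive_half g s (g' s)) ->
    (forall j s, (j < N)%nat -> 0 <= s -> Rabs (c j s) <= g' s) ->
    forall j s, (j < N)%nat -> 0 <= s -> Rabs (theta j s - phi j s) <= K + (g s - g 0)).
  { intros g g' Dg Hg j s Hj Hs.
    set (w := Derive_half (theta j)).
    (* Subtracting the two equations gives [p' = c j]: the second derivative of [theta j] is
       absorbed in [p]. *)
    set (p := fun s => (theta j s - phi j s) + m * w s).
    assert (Hp : Rabs (p s - p 0) <= g s - g 0).
    { apply (derive_half_abs_le p g (c j) g'); auto; [lra|].
      intros r Hr.
      destruct (inertial_derivatives _ _ _ _ _ _ _ j r Hth Hj Hr) as [H1 [H2 H3]].
      destruct (kuramoto_derivatives _ _ _ _ _ j r Hphi Hj Hr) as [H4 H5].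
      replace (c j r) with (Derive_half (theta j) r - Derive_half (phi j) r
                            + m * Derive_half w r) by (unfold c, w; lra).
      apply is_derive_half_plus; [exact Hr| |].
      - apply is_derive_half_minus; auto using Derive_half_correct.
      - apply is_derive_half_scal; auto using Derive_half_correct. }
    assert (W0 : w 0 = omega0 j) by apply (Hth j Hj).
    (* Both velocities are compared with [nu j]: relaxation gives [Om + kappa] for [w s], and
       [omega0 j] adds another [Om]. *)
    assert (Hw : Rabs (m * (w s - omega0 j)) <= K).
    { rewrite Rabs_mult, (Rabs_pos_eq m) by lra.
      apply Rmult_le_compat_l; [lra|].
      assert (B := inertial_velocity_bound _ _ _ _ _ _ _ j (nu j) s HN Hk Hm Hth Hj Hs).
      replace (w s - omega0 j) with ((w s - nu j) - (omega0 j - nu j)) by ring.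
      unfold Rminus at 1; eapply Rle_trans; [apply Rabs_triang|]; rewrite Rabs_Ropp.
      replace (nu j - nu j) with 0 in B by ring; rewrite Rabs_R0 in B.
      specialize (HOm j Hj).
      generalize (exp_relaxation_le_1 m s Hm Hs) (Rabs_pos (omega0 j - nu j)).
      fold w in B; nra. }
    assert (E0 : theta j 0 = phi j 0).
    { rewrite (proj1 (Hth j Hj)); symmetry; apply (Hphi j Hj). }
    replace (theta j s - phi j s) with ((p s - p 0) - m * (w s - omega0 j))
      by (unfold p; rewrite W0, E0; ring).
    unfold Rminus at 1; eapply Rle_trans; [apply Rabs_triang|]; rewrite Rabs_Ropp; lra. }
  assert (Dpow : forall n s, 0 <= s ->
    is_derive_half (fun x => (2 * kappa * x) ^ S n / INR (fact (S n))) s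
      (2 * kappa * ((2 * kappa * s) ^ n / INR (fact n)))).
  { intros n s Hs; apply is_derive_half_extend; [exact Hs|].
    exists (fun x => (2 * kappa * x) ^ S n / INR (fact (S n))); split; [reflexivity|].
    rewrite fact_simpl, mult_INR.
    generalize (INR_fact_neq_0 n) (not_0_INR (S n) (Nat.neq_succ_0 n)).
    generalize (INR (fact n)) as f; intros f Hf HS.
    auto_derive; [exact I|].
    change (2 * kappa * 1 * (INR (S n) * (2 * kappa * s) ^ n) * / (INR (S n) * f)
            = 2 * kappa * ((2 * kappa * s) ^ n / f)).
    field; auto. }
  assert (Dexp : forall s, 0 <= s -> is_derive_half (fun x => K * exp (2 * kappa * x)) s
                   (2 * kappa * (K * exp (2 * kappa * s)))).
  { intros s Hs; apply is_derive_half_extend; [exact Hs|].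
    exists (fun x => K * exp (2 * kappa * x)); split; [reflexivity|].
    auto_derive; [exact I|ring]. }
  assert (exp_ge : forall s, 0 <= s -> 1 <= exp (2 * kappa * s)).
  { intros s Hs; generalize (exp_ineq1_le (2 * kappa * s)).
    assert (0 <= 2 * kappa * s) by (apply Rmult_le_pos; lra); lra. }
  assert (main : forall n j s, (j < N)%nat -> 0 <= s ->
    Rabs (theta j s - phi j s)
      <= K * exp (2 * kappa * s) + (2 * kappa * s) ^ S n / INR (fact (S n))).
  { induction n as [|n IH]; intros j s Hj Hs.
    - eapply Rle_trans.
      + apply (step _ _ (Dpow 0%nat)); auto.
        intros l r Hl Hr; unfold c, Rminus.
        eapply Rle_trans; [apply Rabs_triang|]; rewrite Rabs_Ropp.
        simpl; rewrite Rdiv_1_r.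
        generalize (coupling_bound N kappa (fun j => theta j r) l HN Hk)
          (coupling_bound N kappa (fun j => phi j r) l HN Hk); lra.
      + specialize (exp_ge s Hs); simpl; nra.
    - eapply Rle_trans.
      (* A primitive of [2 * kappa] times the previous bound. Its value at 0 is [K], which cancels
         the additive [K] of [step]. *)
      + apply (step (fun x => K * exp (2 * kappa * x)
                 + (2 * kappa * x) ^ S (S n) / INR (fact (S (S n)))) (fun x =>
                 2 * kappa * (K * exp (2 * kappa * x)) +
                 2 * kappa * ((2 * kappa * x) ^ S n / INR (fact (S n))))); auto.
        * intros r Hr; apply (is_derive_half_plus (fun x => K * exp (2 * kappa * x)));
            auto.
        * intros l r Hl Hr; unfold c.
          rewrite <- Rmult_plus_distr_l; apply coupling_lipschitz; auto.
      + rewrite Rmult_0_r, exp_0, pow_i by lia.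
        unfold Rdiv at 2; lra. }
  apply le_epsilon; intros eps Heps.
  destruct (cv_speed_pow_fact (2 * kappa * t) eps Heps) as [n Hn].
  specialize (Hn (S n) ltac:(lia)); unfold Rdist in Hn; rewrite Rminus_0_r in Hn.
  eapply Rle_trans; [apply (main n); auto|].
  apply Rplus_le_compat_l; eapply Rle_trans; [apply Rle_abs|lra].
Qed.

(** * Smoothness and equations for the higher derivatives *)

Lemma smooth_half_const (v : R) : smooth_half (fun _ => v).
Proof. apply (jet_smooth_half 0 0 (Rabs v)); intros k; apply jet_const; lra. Qed.

Lemma Derive_n_half_const (v : R) (n : nat) (t : R) : 0 <= t ->
  Derive_n_half (fun _ => v) (S n) t = 0.
Proof.
  revert t; induction n as [|n IH]; intros t Ht; apply Derive_half_eq; [exact Ht| |exact Ht|].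
  - now apply is_derive_half_const.
  - apply (is_derive_half_ext (fun _ => 0)); [exact Ht| |now apply is_derive_half_const].
    intros s Hs; symmetry; now apply IH.
Qed.

(** The equation differentiated [n] times. The value [m = 0] is allowed and yields the recurrence of
    the first-order flow; [v] is kept as a constant function so that [n = 0] has the same form as
    the other orders. *)
Lemma derivative_recurrence (m v : R) (f c : R -> R) :
  smooth_half f -> smooth_half c ->
  (forall t, 0 <= t -> m * Derive_half (Derive_half f) t + Derive_half f t = v + c t) ->
  forall n t, 0 <= t ->
  m * Derive_n_half f (S (S n)) t + Derive_n_half f (S n) t
    = Derive_n_half (fun _ => v) n t + Derive_n_half c n t.
Proof.
  intros Hf Hc E; induction n as [|n IH]; intros t Ht; [now apply E|].
  apply (is_derive_half_unique (fun s => Derive_n_half (fun _ => v) n s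
           + Derive_n_half c n s) t); auto.
  - apply (is_derive_half_ext (fun s =>
      m * Derive_n_half f (S (S n)) s + Derive_n_half f (S n) s)); auto.
    apply is_derive_half_plus; auto; [apply is_derive_half_scal; auto|];
      apply is_derive_Derive_n_half; auto.
  - apply is_derive_half_plus; auto; apply is_derive_Derive_n_half;
      auto using smooth_half_const.
Qed.

Lemma inertial_smooth N nu kappa m theta0 omega0 theta i :
  (1 <= N)%nat -> 0 < kappa -> 0 < m ->
  inertial_kuramoto_solution N nu kappa m theta0 omega0 theta ->
  (i < N)%nat -> smooth_half (theta i).
Proof.
  intros HN Hk Hm H Hi.
  set (W := max_idx N (fun j => Rabs (omega0 j))).
  set (V := max_idx N (fun j => Rabs (nu j))).
  assert (HW : forall j, (j < N)%nat -> Rabs (omega0 j) <= W)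
    by (intros; now apply (max_idx_ge N (fun j => Rabs (omega0 j)))).
  assert (HV : forall j, (j < N)%nat -> Rabs (nu j) <= V)
    by (intros; now apply (max_idx_ge N (fun j => Rabs (nu j)))).
  assert (0 < 1 / m) by (apply Rdiv_lt_0_compat; lra).
  generalize (HW i Hi) (Rabs_pos (omega0 i)) (HV i Hi) (Rabs_pos (nu i)); intros.
  apply (smooth_half_of_jet 0 (2 * (kappa + W + V + 1 / m)) (kappa + W + V + 1 / m)).
  - intros t Ht; now apply (inertial_derivatives _ _ _ _ _ _ _ i t H Hi).
  - intros k; apply (inertial_jet N nu kappa m theta0 omega0 theta W V); auto; lra.
Qed.

Lemma kuramoto_smooth N nu kappa theta0 theta i :
  (1 <= N)%nat -> 0 < kappa ->
  kuramoto_solution N nu kappa theta0 theta ->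
  (i < N)%nat -> smooth_half (theta i).
Proof.
  intros HN Hk H Hi.
  set (V := max_idx N (fun j => Rabs (nu j))).
  assert (HV : forall j, (j < N)%nat -> Rabs (nu j) <= V)
    by (intros; now apply (max_idx_ge N (fun j => Rabs (nu j)))).
  apply (smooth_half_of_jet 0 (2 * (kappa + V)) (kappa + V)).
  - intros t Ht; now apply (kuramoto_derivatives _ _ _ _ _ i t H Hi).
  - intros k; apply (kuramoto_jet N nu kappa theta0 theta V); auto; lra.
Qed.

(* The constant [kappa] is absorbed by [A * Q], so no cancellation between the
   two couplings is needed. *)
Lemma derivative_distance N nu kappa m theta0 omega0 theta phi W V A Q t :
  (1 <= N)%nat -> 0 < kappa -> 0 < m ->
  inertial_kuramoto_solution N nu kappa m theta0 omega0 theta ->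
  kuramoto_solution N nu kappa theta0 phi ->
  (forall j, (j < N)%nat -> Rabs (omega0 j) <= W) ->
  (forall j, (j < N)%nat -> Rabs (nu j) <= V) ->
  kappa + W + V <= A -> 1 / m <= A -> 0 <= t ->
  exp (- t / m) <= Q -> kappa <= A * (Q - exp (- t / m)) ->
  forall n i, (i < N)%nat ->
  Rabs (Derive_n_half (theta i) (S n) t - Derive_n_half (phi i) (S n) t)
    <= INR (fact (n + 2)) * 2 ^ S n * A ^ S n * Q.
Proof.
  intros HN Hk Hm Hth Hphi HW HV HA HmA Ht HQ HkQ.
  assert (HW0 := HW 0%nat HN); assert (HV0 := HV 0%nat HN).
  assert (PW := Rabs_pos (omega0 0%nat)); assert (PV := Rabs_pos (nu 0%nat)).
  assert (PE := exp_pos (- t / m)).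
  assert (HAQ : A * exp (- t / m) + kappa <= A * Q) by lra.
  assert (Jth := inertial_jet _ _ _ _ _ _ _ W V A HN Hk Hm Hth HW HV HA HmA).
  assert (Jphi := kuramoto_jet _ _ _ _ _ V A HN Hk Hphi HV ltac:(lra)).
  assert (Hex1 : forall j, (j < N)%nat -> forall s, 0 <= s -> ex_derive_half (theta j) s)
    by (intros j Hj s Hs; now apply (inertial_derivatives _ _ _ _ _ _ _ j s Hth Hj)).
  assert (Hex2 : forall j, (j < N)%nat -> forall s, 0 <= s -> ex_derive_half (phi j) s)
    by (intros j Hj s Hs; now apply (kuramoto_derivatives _ _ _ _ _ j s Hphi Hj)).
  assert (E2 : A = 2 * A / 2) by field.
  assert (Cth : forall k i, (i < N)%nat ->
    jet 0 (2 * A) (S k) 1 kappa (fun s => coupling N kappa (fun j => theta j s) i)).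
  { intros k i Hi; apply jet_coupling; auto; [lra|]; rewrite <- E2; auto. }
  assert (Cphi : forall k i, (i < N)%nat ->
    jet 0 (2 * A) (S k) 1 kappa (fun s => coupling N kappa (fun j => phi j s) i)).
  { intros k i Hi; apply jet_coupling; auto; [lra|]; rewrite <- E2; auto. }
  induction n as [|n IH]; intros i Hi.
  (* With [v = nu i] the drift cancels, leaving [|omega0 i - nu i| exp (- t / m)] plus one [kappa]
     from each flow. *)
  - assert (Bv := inertial_velocity_bound _ _ _ _ _ _ _ i (nu i) t HN Hk Hm Hth Hi Ht).
    replace (nu i - nu i) with 0 in Bv by ring; rewrite Rabs_R0, Rplus_0_l in Bv.
    simpl Derive_n_half.
    rewrite (proj2 (kuramoto_derivatives _ _ _ _ _ i t Hphi Hi Ht)).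
    replace (Derive_half (theta i) t - (nu i + coupling N kappa (fun j => phi j t) i))
      with ((Derive_half (theta i) t - nu i) - coupling N kappa (fun j => phi j t) i) by ring.
    unfold Rminus at 1; eapply Rle_trans; [apply Rabs_triang|]; rewrite Rabs_Ropp.
    assert (Bc := coupling_bound N kappa (fun j => phi j t) i HN Hk).
    assert (Rabs (omega0 i - nu i) <= A).
    { unfold Rminus; eapply Rle_trans; [apply Rabs_triang|]; rewrite Rabs_Ropp.
      specialize (HW i Hi); specialize (HV i Hi); lra. }
    assert (Rabs (omega0 i - nu i) * exp (- t / m) <= A * exp (- t / m))
      by (apply Rmult_le_compat_r; lra).
    assert (0 < A * exp (- t / m)) by (apply Rmult_lt_0_compat; lra).
    simpl; lra.
  - specialize (IH i Hi).
    assert (Sth := smooth_half_of_jet _ _ _ _ (Hex1 i Hi) (fun k => Jth k i Hi)).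
    assert (Sphi := smooth_half_of_jet _ _ _ _ (Hex2 i Hi) (fun k => Jphi k i Hi)).
    assert (SCth := jet_smooth_half _ _ _ _ (fun k => jet_pred _ _ _ _ _ _ (Cth k i Hi))).
    assert (SCphi := jet_smooth_half _ _ _ _ (fun k => jet_pred _ _ _ _ _ _ (Cphi k i Hi))).
    assert (R1 := derivative_recurrence m (nu i) _ _ Sth SCth
      (fun s Hs => proj2 (proj2 (inertial_derivatives _ _ _ _ _ _ _ i s Hth Hi Hs))) n t Ht).
    assert (R0 : forall s, 0 <= s -> 0 * Derive_half (Derive_half (phi i)) s
      + Derive_half (phi i) s = nu i + coupling N kappa (fun j => phi j s) i).
    { intros s Hs; rewrite Rmult_0_l, Rplus_0_l.
      now apply (kuramoto_derivatives _ _ _ _ _ i s Hphi Hi). }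
    assert (R2 := derivative_recurrence 0 (nu i) _ _ Sphi SCphi R0 n t Ht).
    assert (R3 := derivative_recurrence 0 (nu i) _ _ Sphi SCphi R0 (S n) t Ht).
    rewrite Derive_n_half_const in R3 by exact Ht.
    rewrite Rmult_0_l, Rplus_0_l in R2, R3; rewrite Rplus_0_l in R3.
    assert (B1 := jet_1_Derive_n_half _ _ _ _ n t (jet_pred _ _ _ _ _ _ (Cth n i Hi)) Ht Ht).
    assert (B2 := jet_1_Derive_n_half _ _ _ _ n t (jet_pred _ _ _ _ _ _ (Cphi n i Hi)) Ht Ht).
    assert (B3 := jet_1_Derive_n_half _ _ _ _ (S n) t (Cphi n i Hi) Ht Ht).
    set (x1 := Derive_n_half (fun s => coupling N kappa (fun j => theta j s) i) n t) in *.
    set (x2 := Derive_n_half (fun s => coupling N kappa (fun j => phi j s) i) n t) in *.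
    set (x3 := Derive_n_half (fun s => coupling N kappa (fun j => phi j s) i) (S n) t) in *.
    set (d := Derive_n_half (theta i) (S n) t - Derive_n_half (phi i) (S n) t) in *.
    (* The inertial recurrence is solved for its top derivative. Since [R2] gives the lower
       derivative of [phi i] as that of [nu i] plus [x2], the [nu] terms cancel; by [R3] the top
       derivative of [phi i] is [x3]. *)
    replace (Derive_n_half (theta i) (S (S n)) t - Derive_n_half (phi i) (S (S n)) t)
      with (1 / m * (x1 - x2 - d) - x3).
    2: { rewrite R3; unfold d.
         replace (Derive_n_half (phi i) (S n) t) with (Derive_n_half (fun _ => nu i) n t + x2)
           by (symmetry; exact R2).
         apply (Rmult_eq_reg_l m); [|lra]. field_simplify; [|lra]; lra. }
    assert (Pm : 0 < 1 / m) by (apply Rdiv_lt_0_compat; lra).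
    set (P := 2 ^ S n * (A ^ S (S n) * Q)).
    assert (P2A : 0 <= (2 * A) ^ n) by (apply pow_le; lra).
    assert (PA : 0 <= A ^ S n) by (apply pow_le; lra).
    assert (P2 : 0 <= 2 ^ S n) by (apply pow_le; lra).
    assert (HP : 2 * A * kappa * (2 * A) ^ n <= P).
    { unfold P; rewrite Rpow_mult_distr; simpl.
      assert (0 <= A * A ^ n * 2 ^ n) by
        (repeat apply Rmult_le_pos; try apply pow_le; lra).
      assert (kappa <= A * Q) by
        (assert (0 < A * exp (- t / m)) by (apply Rmult_lt_0_compat; lra); lra).
      replace (2 * 2 ^ n * (A * (A * A ^ n) * Q)) with (2 * (A * A ^ n * 2 ^ n) * (A * Q)) by ring.
      replace (2 * A * kappa * (2 ^ n * A ^ n)) with (2 * (A * A ^ n * 2 ^ n) * kappa) by ring.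
      apply Rmult_le_compat_l; lra. }
    assert (P0 : 0 <= P).
    { eapply Rle_trans; [|exact HP]. repeat apply Rmult_le_pos; lra. }
    assert (Hd : 1 / m * Rabs (x1 - x2 - d)
      <= A * (2 * (kappa * INR (fact n) * (2 * A) ^ n)
              + INR (fact (n + 2)) * 2 ^ S n * A ^ S n * Q)).
    { apply Rmult_le_compat; [lra|apply Rabs_pos|exact HmA|].
      unfold Rminus; eapply Rle_trans; [apply Rabs_triang|]; rewrite Rabs_Ropp.
      apply Rplus_le_compat; [|exact IH].
      eapply Rle_trans; [apply Rabs_triang|]; rewrite Rabs_Ropp; lra. }
    unfold Rminus at 1; eapply Rle_trans; [apply Rabs_triang|]; rewrite Rabs_Ropp.
    rewrite Rabs_mult, (Rabs_pos_eq (1 / m)) by lra.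
    (* The factorials come respectively from [x1] and [x2], from the induction hypothesis, and from
       [x3]. Their sum is at most [2 (n + 3)!], and the target is [2 (n + 3)! P]. *)
    apply (Rle_trans _ ((INR (fact n) + INR (fact (n + 2)) + INR (fact (S n))) * P)).
    + assert (F0 := INR_fact_lt_0 n); assert (F1 := INR_fact_lt_0 (S n)).
      replace (A * (2 * (kappa * INR (fact n) * (2 * A) ^ n)
              + INR (fact (n + 2)) * 2 ^ S n * A ^ S n * Q))
        with (INR (fact n) * (2 * A * kappa * (2 * A) ^ n) + INR (fact (n + 2)) * P) in Hd
        by (unfold P; simpl; ring).
      replace (kappa * INR (fact (S n)) * (2 * A) ^ S n)
        with (INR (fact (S n)) * (2 * A * kappa * (2 * A) ^ n)) in B3 by (simpl; ring).
      assert (INR (fact n) * (2 * A * kappa * (2 * A) ^ n) <= INR (fact n) * P)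
        by (apply Rmult_le_compat_l; lra).
      assert (INR (fact (S n)) * (2 * A * kappa * (2 * A) ^ n) <= INR (fact (S n)) * P)
        by (apply Rmult_le_compat_l; lra).
      lra.
    + replace (INR (fact (S n + 2)) * 2 ^ S (S n) * A ^ S (S n) * Q)
        with (2 * INR (fact (S n + 2)) * P) by (unfold P; simpl; ring).
      apply Rmult_le_compat_r; [exact P0|].
      replace (S n + 2)%nat with (S (n + 2)) by lia.
      assert (L1 := le_INR _ _ (fact_le n (S (n + 2)) ltac:(lia))).
      assert (L3 : INR (fact (n + 2)) + INR (fact (S n)) <= INR (fact (S (n + 2)))).
      { rewrite <- plus_INR; apply le_INR.
        assert (L := fact_le (S n) (n + 2) ltac:(lia)).
        rewrite (fact_simpl (n + 2)); nia. }
      lra.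
Qed.

(** * Convergence of the derivatives *)

(** A single term [y ^ n / n!] of the exponential series is at most its sum. *)
Lemma pow_exp_opp_le (y : R) (n : nat) : 0 <= y -> y ^ n * exp (- y) <= INR (fact n).
Proof.
  intros Hy.
  assert (F := INR_fact_lt_0 n); assert (P := exp_pos y).
  assert (Pk : forall k, 0 <= y ^ k / INR (fact k)).
  { intros k; apply Rmult_le_pos; [now apply pow_le|].
    left; apply Rinv_0_lt_compat, INR_fact_lt_0. }
  assert (H : y ^ n / INR (fact n) <= exp y).
  { eapply Rle_trans; [|apply (exp_ge_taylor y n Hy)].
    destruct n as [|n]; [right; reflexivity|].
    rewrite tech5.
    generalize (cond_pos_sum (fun k => y ^ k / INR (fact k)) n Pk); lra. }
  rewrite exp_Ropp; apply (Rmult_le_reg_r (exp y / INR (fact n))).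
  - now apply Rdiv_lt_0_compat.
  - replace (y ^ n * / exp y * (exp y / INR (fact n))) with (y ^ n / INR (fact n))
      by (field; lra).
    now replace (INR (fact n) * (exp y / INR (fact n))) with (exp y) by (field; lra).
Qed.

(** The constant is chosen before [m]. The induction passes from [T / 2] to [T]: bounds from [T / 2]
    on control the differentiated coupling, and relaxation over a time at least [T / 2] damps the
    value at [T / 2], of which only an [m]-dependent bound is known. *)
Lemma inertial_derivatives_bounded N nu kappa theta0 omega0 (theta : R -> nat -> R -> R) W V :
  (1 <= N)%nat -> 0 < kappa ->
  (forall m, 0 < m -> inertial_kuramoto_solution N nu kappa m theta0 omega0 (theta m)) ->
  (forall j, (j < N)%nat -> Rabs (omega0 j) <= W) ->
  (forall j, (j < N)%nat -> Rabs (nu j) <= V) ->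
  forall n T, 0 < T -> exists C, forall m i l t,
    0 < m <= 1 -> (i < N)%nat -> (l <= n)%nat -> T <= t ->
    Rabs (Derive_n_half (theta m i) (S l) t) <= C.
Proof.
  intros HN Hk Hth HW HV.
  assert (HW0 := HW 0%nat HN); assert (HV0 := HV 0%nat HN).
  assert (PW := Rabs_pos (omega0 0%nat)); assert (PV := Rabs_pos (nu 0%nat)).
  induction n as [|n IH]; intros T HT.
  { exists (kappa + W + V); intros m i l t Hm Hi Hl Ht; replace l with 0%nat by lia.
    apply (inertial_velocity_le N nu kappa m theta0 omega0 (theta m)); auto; try lra.
    apply Hth; lra. }
  destruct (IH (T / 2) ltac:(lra)) as [C0 HC0].
  (* With [C >= 1], a plain bound [C] implies the bound [C * k! * (2 C) ^ k] that [jet_intro]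
     expects. *)
  set (C := Rmax 1 C0).
  assert (HC1 : 1 <= C) by apply Rmax_l.
  assert (HC : C0 <= C) by apply Rmax_r.
  set (A1 := kappa + W + V + 1).
  (* [M] bounds the differentiated coupling, [M'] the damped contribution of the value at
     [T / 2]. *)
  set (M := kappa * INR (fact (S n)) * (2 * C) ^ S n).
  set (M' := INR (fact (S n)) * 2 ^ S n * (A1 / (T / 2)) ^ S (S n) * INR (fact (S (S n)))).
  exists (Rmax C0 (M' + M)); intros m i l t Hm Hi Hl Ht.
  destruct (Nat.eq_dec l (S n)) as [->|Hne].
  2: { eapply Rle_trans; [apply (HC0 m i l t); auto; [lia|lra]|apply Rmax_l]. }
  eapply Rle_trans; [|apply Rmax_r].
  assert (Hm0 : 0 < m) by lra; specialize (Hth m Hm0).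
  assert (Sth : forall j, (j < N)%nat -> smooth_half (theta m j))
    by (intros j Hj; now apply (inertial_smooth N nu kappa m theta0 omega0)).
  assert (J : forall j, (j < N)%nat -> jet (T / 2) (2 * C) n 1 C (Derive_half (theta m j))).
  { intros j Hj; replace 1 with (INR 0 + 1) at 1 by (simpl; ring); apply jet_intro.
    - intros k; rewrite Derive_n_half_shift; apply (Sth j Hj (S k)).
    - intros k Hkn s Hs Has; rewrite Derive_n_half_shift.
      eapply Rle_trans; [apply (HC0 m j k s); auto|].
      simpl (0 + k)%nat; simpl (fact 0); rewrite Rdiv_1_r.
      assert (F : 1 <= INR (fact k)).
      { replace 1 with (INR 1) by reflexivity; apply le_INR.
        generalize (lt_O_fact k); lia. }
      assert (P : 1 <= (2 * C) ^ k) by (apply pow_R1_Rle; lra).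
      assert (C * 1 <= C * INR (fact k)) by (apply Rmult_le_compat_l; lra).
      assert (C * INR (fact k) * 1 <= C * INR (fact k) * (2 * C) ^ k)
        by (apply Rmult_le_compat_l; lra).
      lra. }
  set (c := fun s => coupling N kappa (fun j => theta m j s) i).
  assert (Jc : jet (T / 2) (2 * C) (S n) 1 kappa c).
  { apply jet_coupling; auto; [lra| |].
    - intros j Hj; apply (Sth j Hj 0%nat).
    - intros j Hj; replace (2 * C / 2) with C by field; auto. }
  assert (Pm : 0 < 1 / m) by (apply Rdiv_lt_0_compat; lra).
  (* This [A] blows up as [m] tends to 0. It enters only through the smoothness of [c] and the value
     at [T / 2], where the exponential compensates it. *)
  set (A := kappa + W + V + 1 / m).
  assert (JA := inertial_jet _ _ _ _ _ _ _ W V A HN Hk Hm0 Hth HW HV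
                  ltac:(unfold A; lra) ltac:(unfold A; lra)).
  assert (Sc : smooth_half c).
  { apply (jet_smooth_half 0 (2 * A) kappa); intros k; apply jet_pred, jet_coupling; auto.
    - unfold A; lra.
    - intros j Hj; apply (Sth j Hj 0%nat).
    - intros j Hj; replace (2 * A / 2) with A by field; auto. }
  assert (HM : 0 <= M).
  { unfold M; generalize (INR_fact_lt_0 (S n)); intros.
    apply Rmult_le_pos; [apply Rmult_le_pos; lra|apply pow_le; lra]. }
  assert (R := relaxation_bound (Derive_n_half (theta m i) (S (S n)))
    (Derive_n_half (theta m i) (S (S (S n)))) m M (T / 2) t Hm0 ltac:(lra) ltac:(lra) HM).
  eapply Rle_trans; [apply R|apply Rplus_le_compat_r].
  - intros s Hs; apply is_derive_Derive_n_half; [auto|lra].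
  - intros s Hs.
    rewrite (derivative_recurrence m (nu i) (theta m i) c (Sth i Hi) Sc); [|intros r Hr|lra].
    + rewrite Derive_n_half_const, Rplus_0_l by lra.
      apply (jet_1_Derive_n_half (T / 2)); auto; lra.
    + now apply (inertial_derivatives _ _ _ _ _ _ _ i r Hth Hi).
  - assert (B := jet_1_Derive_n_half _ _ _ _ (S n) (T / 2) (JA (S n) i Hi)
                   ltac:(lra) ltac:(lra)).
    rewrite Derive_n_half_shift in B.
    set (y := (T / 2) / m).
    assert (Hy : 0 < y) by (apply Rdiv_lt_0_compat; lra).
    (* As [m <= 1], [A <= A1 / m]. Written through [y = T / (2 m)], the powers of [A] become powers
       of [y], which [exp (- y)] dominates. *)
    assert (HA : A <= A1 / (T / 2) * y).
    { replace (A1 / (T / 2) * y) with (A1 * (1 / m)) by (unfold y; field; lra).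
      assert (1 <= 1 / m).
      { apply (Rmult_le_reg_r m); [lra|]; replace (1 / m * m) with 1 by (field; lra); lra. }
      unfold A, A1; nra. }
    assert (Hexp : exp (- (t - T / 2) / m) <= exp (- y)).
    { assert (Hle : - (t - T / 2) / m <= - y).
      { unfold y; replace (- (t - T / 2) / m) with (- ((t - T / 2) * / m)) by (field; lra).
        apply Ropp_le_contravar, Rmult_le_compat_r; [|lra].
        left; apply Rinv_0_lt_compat; lra. }
      destruct Hle as [Hlt| ->]; [left; now apply exp_increasing|right; reflexivity]. }
    assert (F := INR_fact_lt_0 (S n)).
    assert (A0 : 0 <= A) by (unfold A; lra).
    assert (PA : A ^ S (S n) <= (A1 / (T / 2)) ^ S (S n) * y ^ S (S n)).
    { rewrite <- Rpow_mult_distr; apply pow_incr; lra. }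
    assert (Py := pow_exp_opp_le y (S (S n)) ltac:(lra)).
    assert (D0 : 0 <= (A1 / (T / 2)) ^ S (S n)).
    { apply pow_le; left; apply Rdiv_lt_0_compat; unfold A1; lra. }
    assert (E0 := exp_pos (- y)).
    assert (F2 : 0 <= INR (fact (S n)) * 2 ^ S n)
      by (apply Rmult_le_pos; [lra|apply pow_le; lra]).
    apply (Rle_trans _ (A * INR (fact (S n)) * (2 * A) ^ S n * exp (- y))).
    { apply Rmult_le_compat; auto using Rabs_pos. left; apply exp_pos. }
    replace (A * INR (fact (S n)) * (2 * A) ^ S n)
      with (INR (fact (S n)) * 2 ^ S n * A ^ S (S n))
      by (rewrite Rpow_mult_distr; simpl; ring).
    unfold M'; rewrite !(Rmult_assoc (INR (fact (S n)) * 2 ^ S n)).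
    apply Rmult_le_compat_l; [exact F2|].
    apply (Rle_trans _ ((A1 / (T / 2)) ^ S (S n) * y ^ S (S n) * exp (- y))).
    { apply Rmult_le_compat_r; lra. }
    rewrite Rmult_assoc; apply Rmult_le_compat_l; [exact D0|exact Py].
Qed.

(** A Landau-type inequality: at some point of [[t, t + h]] the derivative equals the difference
    quotient, at most [2 e / h], and from there to [t] it varies by at most [C * h]. *)
Lemma derivative_interpolation (f f1 f2 : R -> R) (t h e C : R) : 0 <= t -> 0 < h ->
  (forall s, t <= s -> is_derive_half f s (f1 s)) ->
  (forall s, t <= s -> is_derive_half f1 s (f2 s)) ->
  (forall s, t <= s -> Rabs (f2 s) <= C) ->
  Rabs (f t) <= e -> Rabs (f (t + h)) <= e ->
  Rabs (f1 t) <= 2 * e / h + C * h.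
Proof.
  intros Ht Hh D1 D2 HC H0 Hh0.
  destruct (MVT_half f f1 t (t + h)) as [x [Hx E]]; auto; [lra|].
  assert (P := derive_half_abs_le f1 (fun s => C * s) f2 (fun _ => C) t x).
  assert (P' : Rabs (f1 x - f1 t) <= C * x - C * t).
  { apply P; auto; [lra|]. intros s Hs.
    replace C with (C * 1) by ring.
    apply (is_derive_half_ext (fun y => C * y)); [lra|intros; ring|].
    apply is_derive_half_scal; [lra|].
    apply is_derive_half_extend; [lra|]; exists (fun y => y); split; [reflexivity|].
    apply (is_derive_id (K := R_AbsRing)). }
  assert (HC0 : 0 <= C) by (eapply Rle_trans; [apply Rabs_pos|apply (HC t); lra]).
  assert (Ex : Rabs (f1 x) <= 2 * e / h).
  { replace (f1 x) with ((f (t + h) - f t) * / h).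
    - rewrite Rabs_mult, (Rabs_pos_eq (/ h)) by (left; now apply Rinv_0_lt_compat).
      apply Rmult_le_compat_r; [left; now apply Rinv_0_lt_compat|].
      unfold Rminus; eapply Rle_trans; [apply Rabs_triang|]; rewrite Rabs_Ropp; lra.
    - rewrite E; field; lra. }
  replace (f1 t) with (f1 x - (f1 x - f1 t)) by ring.
  unfold Rminus at 1; eapply Rle_trans; [apply Rabs_triang|]; rewrite Rabs_Ropp.
  apply Rplus_le_compat; [exact Ex|].
  eapply Rle_trans; [exact P'|].
  rewrite <- Rmult_minus_distr_l; apply Rmult_le_compat_l; lra.
Qed.

Lemma at_right_0_intro (P : R -> Prop) (d : R) : 0 < d ->
  (forall m, 0 < m < d -> P m) -> at_right 0 P.
Proof.
  intros Hd H; exists (mkposreal d Hd); intros m Hm H0.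
  apply H; apply Rabs_lt_between' in Hm; simpl in Hm; lra.
Qed.

(** Order 0 converges uniformly down to [t = 0]; higher orders are treated away from the initial
    layer, hence the disjunction. Each order follows from the previous one by interpolation against
    bounds uniform in [m]. *)
Lemma kuramoto_derivatives_converge N nu kappa theta0 omega0 (theta : R -> nat -> R -> R) phi i :
  (1 <= N)%nat -> 0 < kappa ->
  (forall m, 0 < m -> inertial_kuramoto_solution N nu kappa m theta0 omega0 (theta m)) ->
  kuramoto_solution N nu kappa theta0 phi -> (i < N)%nat ->
  forall n T1 T2, 0 <= T1 -> T1 <= T2 -> (n = 0%nat \/ 0 < T1) ->
  forall eps, 0 < eps -> exists d, 0 < d /\ forall m t, 0 < m < d -> T1 <= t <= T2 ->
    Rabs (Derive_n_half (theta m i) n t - Derive_n_half (phi i) n t) < eps.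
Proof.
  intros HN Hk Hth Hphi Hi.
  set (W := max_idx N (fun j => Rabs (omega0 j))).
  set (V := max_idx N (fun j => Rabs (nu j))).
  assert (HW : forall j, (j < N)%nat -> Rabs (omega0 j) <= W)
    by (intros; now apply (max_idx_ge N (fun j => Rabs (omega0 j)))).
  assert (HV : forall j, (j < N)%nat -> Rabs (nu j) <= V)
    by (intros; now apply (max_idx_ge N (fun j => Rabs (nu j)))).
  assert (Sphi := kuramoto_smooth _ _ _ _ _ i HN Hk Hphi Hi).
  induction n as [|n IH]; intros T1 T2 HT1 HT H0 eps Heps.
  - set (Om := max_idx N (fun j => Rabs (omega0 j - nu j))).
    assert (HOm : forall j, (j < N)%nat -> Rabs (omega0 j - nu j) <= Om)
      by (intros; now apply (max_idx_ge N (fun j => Rabs (omega0 j - nu j)))).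
    assert (POm : 0 <= Om) by (eapply Rle_trans; [apply Rabs_pos|apply (HOm i Hi)]).
    assert (PE := exp_pos (2 * kappa * T2)).
    set (L := (2 * Om + kappa) * exp (2 * kappa * T2)).
    assert (HL : 0 < L) by (apply Rmult_lt_0_compat; lra).
    exists (eps / L); split; [now apply Rdiv_lt_0_compat|].
    intros m t Hm Ht; simpl.
    eapply Rle_lt_trans; [apply (kuramoto_distance N nu kappa m theta0 omega0 _ _ Om);
      auto; try lra; apply Hth; lra|].
    apply (Rle_lt_trans _ (m * L)).
    + unfold L; rewrite <- Rmult_assoc; apply Rmult_le_compat_l.
      * apply Rmult_le_pos; lra.
      * assert (Hle : 2 * kappa * t <= 2 * kappa * T2) by (apply Rmult_le_compat_l; lra).
        destruct Hle as [Hlt| ->]; [left; now apply exp_increasing|right; reflexivity].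
    + apply (Rmult_lt_reg_r (/ L)); [now apply Rinv_0_lt_compat|].
      rewrite Rmult_assoc, Rinv_r, Rmult_1_r by lra; apply Hm.
  - destruct H0 as [H0|HT0]; [discriminate|].
    destruct (inertial_derivatives_bounded N nu kappa theta0 omega0 theta W V HN Hk Hth HW HV
                (S n) T1 HT0) as [C1 HC1].
    assert (PV : 0 <= V) by (eapply Rle_trans; [apply Rabs_pos|apply (HV i Hi)]).
    set (C2 := (kappa + V) * INR (fact (S n)) * (2 * (kappa + V)) ^ S n).
    assert (HC2 : forall t, 0 <= t -> Rabs (Derive_n_half (phi i) (S (S n)) t) <= C2).
    { intros t Ht; rewrite <- Derive_n_half_shift.
      apply (jet_1_Derive_n_half 0); auto.
      apply (kuramoto_jet N nu kappa theta0 phi V); auto; lra. }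
    set (C := Rmax 0 (C1 + C2)).
    assert (PC : 0 <= C) by apply Rmax_l.
    (* This makes the term [C * h] at most [eps / 4]; the accuracy [eps * h / 8] at order [n] turns
       [2 e / h] into another [eps / 4]. *)
    set (h := eps / (4 * (C + 1))).
    assert (Hh : 0 < h) by (apply Rdiv_lt_0_compat; lra).
    assert (HCh : C * h <= eps / 4).
    { replace (eps / 4) with ((C + 1) * h) by (unfold h; field; lra).
      apply Rmult_le_compat_r; lra. }
    (* The forward difference at [t <= T2] looks as far as [T2 + h], so the interval is enlarged. *)
    destruct (IH T1 (T2 + h) HT1 ltac:(lra) ltac:(now right) (eps * h / 8)) as [d [Hd H]].
    { apply Rdiv_lt_0_compat; [now apply Rmult_lt_0_compat|lra]. }
    exists (Rmin d 1); split; [apply Rmin_pos; lra|].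
    intros m t [Hm0 Hm] Ht.
    assert (Hmd : m < d) by (eapply Rlt_le_trans; [exact Hm|apply Rmin_l]).
    assert (Hm1 : m < 1) by (eapply Rlt_le_trans; [exact Hm|apply Rmin_r]).
    assert (Sth := inertial_smooth _ _ _ _ _ _ _ i HN Hk Hm0 (Hth m Hm0) Hi).
    assert (I0 := derivative_interpolation
      (fun s => Derive_n_half (theta m i) n s - Derive_n_half (phi i) n s)
      (fun s => Derive_n_half (theta m i) (S n) s - Derive_n_half (phi i) (S n) s)
      (fun s => Derive_n_half (theta m i) (S (S n)) s - Derive_n_half (phi i) (S (S n)) s)
      t h (eps * h / 8) C).
    assert (R : Rabs (Derive_n_half (theta m i) (S n) t - Derive_n_half (phi i) (S n) t)
                <= 2 * (eps * h / 8) / h + C * h).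
    { apply I0; [lra|exact Hh|intros s Hs..| |].
      - apply is_derive_half_minus; [lra| |]; apply is_derive_Derive_n_half; auto; lra.
      - apply is_derive_half_minus; [lra| |]; apply is_derive_Derive_n_half; auto; lra.
      - unfold Rminus; eapply Rle_trans; [apply Rabs_triang|]; rewrite Rabs_Ropp.
        eapply Rle_trans; [|apply Rmax_r].
        apply Rplus_le_compat; [apply HC1; auto; lra|apply HC2; lra].
      - left; apply H; lra.
      - left; apply H; lra. }
    replace (2 * (eps * h / 8) / h) with (eps / 4) in R by (field; lra).
    lra.
Qed.

(** * Both modes of convergence with their explicit bounds *)

Theorem theorem1p3 :
  forall (N : nat) (theta0 omega0 nu : nat -> R) (kappa : R)
         (theta : R -> nat -> R -> R),
  (1 <= N)%nat ->
  0 < kappa ->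
  (forall m : R, 0 < m ->
     inertial_kuramoto_solution N nu kappa m theta0 omega0 (theta m)) ->
  kuramoto_solution N nu kappa theta0 (theta 0) ->
  ((forall i : nat, (i < N)%nat ->
      cvg_C0_half (fun m => theta m i) (theta 0 i)) /\
   (forall (m : R) (i : nat) (t : R), 0 < m -> (i < N)%nat -> 0 <= t ->
      Rabs (theta m i t - theta 0 i t)
        <= m * (2 * max_idx N (fun j => Rabs (omega0 j - nu j)) + kappa)
             * exp (2 * kappa * t)))
  /\
  ((forall i : nat, (i < N)%nat ->
      cvg_Cinf_pos (fun m => theta m i) (theta 0 i)) /\
   (forall (m : R) (i : nat), 0 < m -> (i < N)%nat ->
      smooth_half (theta m i) /\ smooth_half (theta 0 i) /\
      forall (n : nat) (t : R), (1 <= n)%nat -> 0 <= t ->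
        Rabs (Derive_n_half (theta m i) n t - Derive_n_half (theta 0 i) n t)
          <= INR (fact (n + 1)) * 2 ^ n
             * (kappa + max_idx N (fun j => Rabs (omega0 j))
                  + max_idx N (fun j => Rabs (nu j)) + 1 / m) ^ n
             * ((1 + t / m) ^ n * exp (- t / m)
                    * (1 + m * kappa * exp (2 * kappa * t))
                + m * kappa * exp (2 * kappa * t)))).
Proof.
  intros N theta0 omega0 nu kappa theta HN Hk Hth H0.
  assert (Sth : forall m i, 0 < m -> (i < N)%nat -> smooth_half (theta m i))
    by (intros m i Hm Hi; apply (inertial_smooth N nu kappa m theta0 omega0); auto).
  assert (S0 : forall i, (i < N)%nat -> smooth_half (theta 0 i))
    by (intros i Hi; now apply (kuramoto_smooth N nu kappa theta0)).
  repeat split.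
  - intros i Hi T HT eps Heps.
    destruct (kuramoto_derivatives_converge N nu kappa theta0 omega0 theta (theta 0) i
      HN Hk Hth H0 Hi 0 0 T ltac:(lra) ltac:(lra) ltac:(now left) eps Heps) as [d [Hd H]].
    apply (at_right_0_intro _ d Hd); intros m Hm t Ht; now apply H.
  - intros m i t Hm Hi Ht; apply (kuramoto_distance N nu kappa m theta0 omega0); auto.
    intros j Hj; now apply (max_idx_ge N (fun j => Rabs (omega0 j - nu j))).
  - intros m Hm n t Ht; now apply Derive_n_half_interior; auto.
  - intros n t Ht; now apply Derive_n_half_interior; auto.
  - intros n T1 T2 HT1 HT eps Heps.
    destruct (kuramoto_derivatives_converge N nu kappa theta0 omega0 theta (theta 0) i
      HN Hk Hth H0 H n T1 T2 ltac:(lra) ltac:(lra) ltac:(now right) eps Heps) as [d [Hd Hc]].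
    apply (at_right_0_intro _ d Hd); intros m Hm t Ht.
    destruct (Derive_n_half_interior (theta m i) ltac:(apply Sth; auto; lra) n t ltac:(lra))
      as [_ ->].
    destruct (Derive_n_half_interior (theta 0 i) ltac:(auto) n t ltac:(lra)) as [_ ->].
    now apply Hc.
  - now apply Sth.
  - now apply S0.
  - intros n t Hn Ht; destruct n as [|n]; [lia|].
    set (W := max_idx N (fun j => Rabs (omega0 j))).
    set (V := max_idx N (fun j => Rabs (nu j))).
    assert (HW : forall j, (j < N)%nat -> Rabs (omega0 j) <= W)
      by (intros; now apply (max_idx_ge N (fun j => Rabs (omega0 j)))).
    assert (HV : forall j, (j < N)%nat -> Rabs (nu j) <= V)
      by (intros; now apply (max_idx_ge N (fun j => Rabs (nu j)))).
    assert (PW : 0 <= W) by (eapply Rle_trans; [apply Rabs_pos|apply (HW i); auto]).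
    assert (PV : 0 <= V) by (eapply Rle_trans; [apply Rabs_pos|apply (HV i); auto]).
    assert (Pm : 0 < 1 / m) by (apply Rdiv_lt_0_compat; lra).
    set (A := kappa + W + V + 1 / m).
    assert (PE := exp_pos (- t / m)).
    set (G := m * kappa * exp (2 * kappa * t)).
    assert (HG : m * kappa <= G).
    { unfold G; rewrite <- (Rmult_1_r (m * kappa)) at 1.
      apply Rmult_le_compat_l; [apply Rmult_le_pos; lra|].
      generalize (exp_ineq1_le (2 * kappa * t)).
      assert (0 <= 2 * kappa * t) by (apply Rmult_le_pos; lra); lra. }
    assert (PG : 0 < G) by (eapply Rlt_le_trans; [|exact HG]; apply Rmult_lt_0_compat; lra).
    (* From [1 / m <= A] and [m * kappa <= G]; this is the condition on [Q = exp (- t / m) + G] in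
       [derivative_distance]. *)
    assert (HkG : kappa <= A * G).
    { apply (Rle_trans _ (1 / m * (m * kappa))); [right; field; lra|].
      apply Rmult_le_compat; try (unfold A; lra). apply Rmult_le_pos; lra. }
    eapply Rle_trans.
    + apply (derivative_distance N nu kappa m theta0 omega0 (theta m) (theta 0) W V A
               (exp (- t / m) + G)); auto; try (unfold A; lra).
      now replace (exp (- t / m) + G - exp (- t / m)) with G by ring.
    + replace (S n + 1)%nat with (n + 2)%nat by lia.
      apply Rmult_le_compat_l.
      * apply Rmult_le_pos; [|apply pow_le; unfold A; lra].
        apply Rmult_le_pos; [apply pos_INR|apply pow_le; lra].
      (* The stated bracket dominates [exp (- t / m) + G], because [(1 + t / m) ^ S n] and [1 + G]
         are at least 1. *)
      * assert (P1 : 1 <= (1 + t / m) ^ S n).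
        { apply pow_R1_Rle.
          assert (0 <= t / m) by (apply Rmult_le_pos; [lra|left; now apply Rinv_0_lt_compat]).
          lra. }
        assert (exp (- t / m) <= (1 + t / m) ^ S n * exp (- t / m)) by nra.
        nra.
Qed.
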